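(* Let $\mathcal V$ (followers) and $\mathcal V_L$ (leaders) be finite nonempty disjoint sets, $m\ge1$, and consider the containment control algorithm with static leaders $$\dot x_i(t)=\sum_{j\in\mathcal V,\ j\ne i}a_{ij}(t)\bigl(x_j(t-h_{ij}(t))-x_i(t)\bigr)+\sum_{k\in\mathcal V_L}b_{ik}(t)\bigl(x_k-x_i(t)\bigr),\qquad i\in\mathcal V,$$ where $x_i(t)\in\mathbb R^m$, $x_k\in\mathbb R^m$ ($k\in\mathcal V_L$) are constant, $a_{ij},b_{ik}:[0,\infty)\to[0,\infty)$ are locally Lebesgue integrable, $\bar h\ge0$ and $h_{ij}:[0,\infty)\to[0,\bar h]$ are Lebesgue measurable. Let $d_i(t)=\sum_{k\in\mathcal V_L}b_{ik}(t)$, let $\omega\notin\mathcal V$, and let $\hat A(t)=(\hat a_{ij}(t))_{i,j\in\mathcal V\cup\{\omega\}}$ be defined by $\hat a_{ij}=a_{ij}$ for $i,j\in\mathcal V$, $\hat a_{i\omega}=d_i$ for $i\in\mathcal V$, $\hat a_{\omega j}=0$ for $j\in\mathcal V$, $\hat a_{\omega\omega}=0$. If $\hat A(\cdot)$ is aperiodically quasi-strongly connected (AQSC) and $\sup_{t\ge0,\ i,j}\int_t^{t+D}\hat a_{ij}(s)\,ds<\infty$ for every finite $D>0$ (the latter condition can be discarded if $\bar h=0$), then the algorithm provides containment.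
   Context: For a starting time $t_*\ge0$, the initial condition prescribes $x_i(t_* )$ and $x_i(t_*+s)=\varphi_i(s)$, $s\in[-\bar h,0)$, $i\in\mathcal V$, with $\varphi_i$ bounded Borel; the solution is locally absolutely continuous on $[t_*,\infty)$ and satisfies the equation for almost all $t\ge t_*$. The algorithm provides containment if for every starting time, any initial condition and any positions of the leaders, $\operatorname{dist}(x_i(t),\mathcal C_L)\to0$ as $t\to\infty$ for all $i\in\mathcal V$, where $\mathcal C_L$ is the convex hull of $\{x_k\}_{k\in\mathcal V_L}$ and $\operatorname{dist}$ is the Euclidean distance to a set. For a nonnegative matrix $M=(m_{ij})$ indexed by $\hat{\mathcal V}=\mathcal V\cup\{\omega\}$, $\mathcal G[M]$ has node set $\hat{\mathcal V}$ and an arc $(j,i)$ whenever $m_{ij}>0$. A directed graph is quasi-strongly connected if some node is connected to every other node by a directed walk. $\mathcal G[M]$ is quasi-strongly $\varepsilon$-connected if the graph keeping only arcs $(j,i)$ with $m_{ij}\ge\varepsilon$ is quasi-strongly connected. AQSC of $\hat A(\cdot)$: there exist $\varepsilon>0$ and an increasing sequence $0\le t_0<t_1<\dots$, $t_p\to\infty$, such that (i) $\mathcal G\bigl[\int_{t_p}^{t_{p+1}}\hat A(s)\,ds\bigr]$ is quasi-strongly $\varepsilon$-connected for every $p$; (ii) $\sup_{p\ge0,\ i\ne j}\int_{t_p}^{t_{p+1}}\hat a_{ij}(s)\,ds<\infty$. *)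

(* Defs.v *)
From HB Require Import structures.
From mathcomp Require Import all_boot all_order all_algebra.
From mathcomp Require Import all_classical all_reals all_analysis.

Set Implicit Arguments.
Unset Strict Implicit.
Unset Printing Implicit Defensive.

Import Order.TTheory GRing.Theory Num.Theory.
Import numFieldNormedType.Exports.

Local Open Scope classical_set_scope.
Local Open Scope ring_scope.

(* R with its Lebesgue (not merely Borel) sigma-algebra: the domain on which
   [completed_lebesgue_measure] is a measure. *)
Notation lebesgueTypeR R :=
  (caratheodory_type (mu_ext (@wlength R idfun))) (only parsing).

Notation leb := completed_lebesgue_measure.

Definition lebesgue_measurable_fun (R : realType) (D : set R) (f : R -> R) :=
  measurable_fun (D : set (lebesgueTypeR R))
    (f : lebesgueTypeR R -> measurableTypeR R).

(* Functions on the half-line [0, +oo[ are represented by total functions on R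
   whose values at negative arguments are irrelevant. *)
Definition locally_lebesgue_integrable (R : realType) (f : R -> R) :=
  forall T : R, 0 <= T -> leb.-integrable `[0, T] (EFin \o f).

(* The library norm on row vectors is the sup norm. *)
Definition enorm (R : realType) (m : nat) (v : 'rV[R]_m) : R :=
  Num.sqrt (\sum_(c < m) v ord0 c ^+ 2).

Definition dist_to (R : realType) (m : nat) (y : 'rV[R]_m) (C : set 'rV[R]_m) : R :=
  inf [set enorm (y - z) | z in C].

Definition convex_hull (R : realType) (m : nat) (A : set 'rV[R]_m) :
    set 'rV[R]_m :=
  smallest (@convex_set R 'rV[R]_m) A.

Definition bounded_borel (R : realType) (m : nat) (D : set R)
    (phi : R -> 'rV[R]_m) :=
  measurable_fun (D : set (measurableTypeR R))
    (phi : measurableTypeR R -> g_sigma_algebraType (@open 'rV[R]_m)) /\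
  [bounded phi s | s in D].

Definition absolutely_continuous_on (R : realType) (m : nat) (lo hi : R)
    (f : R -> 'rV[R]_m) :=
  forall e : R, 0 < e -> exists2 d : R, 0 < d &
    forall (n : nat) (u v : 'I_n -> R),
      (forall k, lo <= u k /\ u k <= v k /\ v k <= hi) ->
      trivIset [set: 'I_n] (fun k => `]u k, v k[%classic) ->
      \sum_(k < n) (v k - u k) < d ->
      \sum_(k < n) enorm (f (v k) - f (u k)) < e.

Definition locally_absolutely_continuous (R : realType) (m : nat) (t0 : R)
    (f : R -> 'rV[R]_m) :=
  forall T : R, t0 <= T -> absolutely_continuous_on t0 T f.

Definition containment_rhs (R : realType) (V VL : finType) (m : nat)
    (a : V -> V -> R -> R) (b : V -> VL -> R -> R) (h : V -> V -> R -> R)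
    (xL : VL -> 'rV[R]_m) (x : V -> R -> 'rV[R]_m) (i : V) (t : R) : 'rV[R]_m :=
  \sum_(j | j != i) a i j t *: (x j (t - h i j t) - x i t) +
  \sum_k b i k t *: (xL k - x i t).

(* [x0 i] prescribes x_i(t0); [phi i] prescribes x_i(t0 + s) for s in
   [-hbar, 0[ and its other values are irrelevant. *)
Definition is_solution (R : realType) (V VL : finType) (m : nat)
    (a : V -> V -> R -> R) (b : V -> VL -> R -> R) (hbar : R)
    (h : V -> V -> R -> R) (xL : VL -> 'rV[R]_m) (t0 : R)
    (x0 : V -> 'rV[R]_m) (phi : V -> R -> 'rV[R]_m) (x : V -> R -> 'rV[R]_m) :=
  [/\ forall i, x i t0 = x0 i,
      forall i s, - hbar <= s -> s < 0 -> x i (t0 + s) = phi i s,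
      forall i, locally_absolutely_continuous t0 (x i) &
      {ae leb, forall t : R, t0 <= t -> forall i,
         is_derive (t : R^o) (1 : R^o) (x i) (containment_rhs a b h xL x i t)}].

Definition provides_containment (R : realType) (V VL : finType) (m : nat)
    (a : V -> V -> R -> R) (b : V -> VL -> R -> R) (hbar : R)
    (h : V -> V -> R -> R) :=
  forall (t0 : R) (x0 : V -> 'rV[R]_m) (phi : V -> R -> 'rV[R]_m)
         (xL : VL -> 'rV[R]_m) (x : V -> R -> 'rV[R]_m),
    0 <= t0 ->
    (forall i, bounded_borel `[- hbar, 0[ (phi i)) ->
    is_solution a b hbar h xL t0 x0 phi x ->
    forall i, dist_to (x i t) (convex_hull (range xL)) @[t --> +oo] --> (0 : R).

(* The node omega is [None]. *)
Definition hatA (R : realType) (V VL : finType)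
    (a : V -> V -> R -> R) (b : V -> VL -> R -> R)
    (i j : option V) (t : R) : R :=
  match i, j with
  | Some i, Some j => a i j t
  | Some i, None => \sum_k b i k t
  | None, _ => 0
  end.

(* [graph_of M j i] is the arc from j to i. *)
Definition graph_of (R : realType) (N : finType) (M : N -> N -> R) : rel N :=
  [rel j i | 0 < M i j].

Definition quasi_strongly_connected (N : finType) (e : rel N) :=
  exists r : N, forall v : N, connect e r v.

Definition quasi_strongly_eps_connected (R : realType) (N : finType)
    (eps : R) (M : N -> N -> R) :=
  quasi_strongly_connected [rel j i | graph_of M j i && (eps <= M i j)].

Definition AQSC (R : realType) (N : finType) (A : N -> N -> R -> R) :=
  exists (eps : R) (t : nat -> R),
    [/\ 0 < eps, 0 <= t 0%N, forall p, t p < t p.+1, t p @[p --> \oo] --> +oo &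
     (forall p, quasi_strongly_eps_connected eps
        (fun i j => \int[leb]_(s in `[t p, t p.+1]) A i j s)) /\
     (ereal_sup [set y | exists (p : nat) (i j : N), i != j /\
        y = \int[leb]_(s in `[t p, t p.+1]) (A i j s)%:E] < +oo)%E].

Definition uniformly_bounded_integrals (R : realType) (N : finType)
    (A : N -> N -> R -> R) :=
  forall D : R, 0 < D ->
    (ereal_sup [set y | exists (t : R) (i j : N), (0 <= t)%R /\
       y = \int[leb]_(s in `[t, (t + D)%R]) (A i j s)%:E] < +oo)%E.

(* Main.v *)
Require Import Defs.
From HB Require Import structures.
From mathcomp Require Import all_boot all_order all_algebra.
From mathcomp Require Import all_classical all_reals all_analysis measurable_realfun.
From mathcomp Require Import ring lra.

Set Implicit Arguments.
Unset Strict Implicit.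
Unset Printing Implicit Defensive.

Import Order.TTheory GRing.Theory Num.Theory.
Import numFieldNormedType.Exports.

Local Open Scope classical_set_scope.
Local Open Scope ring_scope.

(** Why containment holds.  Fix a vector u and let k0 maximize <u, x_k> over the
    leaders.  The excess F_i = <u, x_i> - <u, x_k0> of follower i, together with
    F_omega = 0 for the node that collects all the leaders, satisfies almost
    everywhere the delayed differential inequality
      F_i'(t) <= \sum_(j != i) \hat a_ij(t) (F_j(t - h_ij(t)) - F_i(t)),
    so it suffices to show that the positive part of F tends to 0 at a rate which
    depends on u only through |u|.  The distance from x_i(t) to the hull is then
    controlled by testing the excess in the direction from a nearly closest point
    of the hull to x_i(t) ([dist_hull_le]).

    The scalar inequality is handled by one comparison principle ([comparison]):
    a nonnegative absolutely continuous y with y' >= beta - alpha y satisfies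
    y(t) >= exp(- \int alpha) (y(s) + \int beta).
    Applied to y = K - F_i it gives three facts.  A bound F <= K on a delay
    window persists forever ([max_principle]).  A gap F_i <= K - eta shrinks at
    most by the factor exp(- \int inflow) ([gap_persists]).  An arc (j, i) with
    integrated weight at least eps transmits to i a gap that j keeps throughout a
    window ([gap_spreads]).

    The root of the connectivity graphs has to be omega, which has no incoming
    arcs and whose gap is the whole of K.  Choose windows [tau k, sigma k] of the
    connectivity sequence which are separated by at least the maximal delay, so
    that the delayed values used in one window already carry the gap gained in the
    preceding one; the total inflow between consecutive windows stays bounded
    ([aqsc_windows]).  Every window enlarges the set of nodes that carry a gap,
    whence after as many windows as there are nodes the bound K is multiplied by a
    fixed q < 1 ([contraction], [geometric_decay]).

    On the analytic side, the comparison principle rests on the monotonicity of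
    absolutely continuous functions with almost everywhere nonnegative derivative
    ([ac_nondecreasing]) and on the differentiability almost everywhere of
    indefinite integrals of the weights.  The weights are measurable for the
    completed measure, so they are first replaced by Borel functions
    ([borel_version], [primitive_exists]). *)

(** * Absolutely continuous functions of a real variable *)

(** Finite families of nonoverlapping intervals are listed from left to right:
    adding one more interval on the right is then a plain [rcons]. *)
Definition chain (R : realType) (s t : R) (l : seq (R * R)) :=
  all (fun p => (s <= p.1) && (p.1 <= p.2) && (p.2 <= t)) l &&
  pairwise (fun p q => p.2 <= q.1) l.

Definition ac (R : realType) (s t : R) (y : R -> R) :=
  forall e : R, 0 < e -> exists2 d : R, 0 < d &
    forall l, chain s t l -> \sum_(p <- l) (p.2 - p.1) < d ->
      \sum_(p <- l) `|y p.2 - y p.1| < e.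

Lemma acS (R : realType) (s t s' t' : R) y : s <= s' -> t' <= t ->
  ac s t y -> ac s' t' y.
Proof.
move=> ss tt acy e /acy[d d0 H]; exists d => // l /andP[la lp]; apply: H.
rewrite /chain lp andbT; apply: sub_all la => p /andP[/andP[p1 p2] p3].
by rewrite (le_trans ss p1) p2 (le_trans p3 tt).
Qed.

(** All closure properties of absolute continuity reduce to a bound of the
    increments of the new function by those of two old ones. *)
Lemma ac_dominated (R : realType) (s t : R) (c : R) y z w :
  (forall u v, s <= u -> u <= v -> v <= t ->
     `|w v - w u| <= c * (`|y v - y u| + `|z v - z u|)) ->
  ac s t y -> ac s t z -> ac s t w.
Proof.
move=> H acy acz e e0.
pose k := e / (2 * (`|c| + 1)).
have c1 : 0 < 2 * (`|c| + 1) by rewrite mulr_gt0// ltr_wpDl.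
have k0 : 0 < k by rewrite divr_gt0.
have [d1 d10 H1] := acy _ k0; have [d2 d20 H2] := acz _ k0.
exists (Num.min d1 d2); first by rewrite lt_min d10.
move=> l cl; rewrite lt_min => /andP[/(H1 _ cl) K1 /(H2 _ cl) K2].
apply: (@le_lt_trans _ _ (\sum_(p <- l) `|c| * (`|y p.2 - y p.1| + `|z p.2 - z p.1|))).
  rewrite big_seq [leRHS]big_seq; apply: ler_sum => p pl.
  case/andP : cl => /allP/(_ _ pl)/andP[/andP[p1 p2] p3] _.
  by apply: (le_trans (H _ _ p1 p2 p3)); rewrite ler_wpM2r ?ler_norm// addr_ge0.
rewrite -mulr_sumr big_split/=.
have : `|c| * (\sum_(i <- l) `|y i.2 - y i.1| + \sum_(i <- l) `|z i.2 - z i.1|)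
   <= `|c| * (k + k) by rewrite ler_wpM2l// ltW// ltrD.
move=> /le_lt_trans; apply.
have -> : e = (`|c| + 1) * (k + k) by rewrite /k; field; rewrite gt_eqF// ltr_wpDl.
by rewrite ltr_pM2r ?ltrDl// addr_gt0.
Qed.

Lemma acD (R : realType) (s t : R) y z :
  ac s t y -> ac s t z -> ac s t (fun x => y x + z x).
Proof.
apply: (@ac_dominated _ _ _ 1) => u v _ _ _; rewrite mul1r.
by apply: le_trans (ler_normD _ _); rewrite opprD addrACA.
Qed.

Lemma acZ (R : realType) (s t c : R) y : ac s t y -> ac s t (fun x => c * y x).
Proof.
move=> acy; apply: (@ac_dominated _ _ _ `|c| y y) => // u v _ _ _.
by rewrite -mulrBr normrM ler_wpM2l// lerDl.
Qed.

Lemma ac_cst (R : realType) (s t c : R) : ac s t (fun=> c).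
Proof.
move=> e e0; exists 1 => // l _ _.
by rewrite big1// => p _; rewrite subrr normr0.
Qed.

Lemma acB (R : realType) (s t : R) y z :
  ac s t y -> ac s t z -> ac s t (fun x => y x - z x).
Proof.
move=> acy /(@acZ _ _ _ (-1)) /(acD acy).
by rewrite (_ : (fun _ => _ + _) = fun x => y x - z x)//; apply/funext => x; rewrite mulN1r.
Qed.

Lemma ac_sum (R : realType) (s t : R) (I : Type) (r : seq I) (P : pred I)
    (y : I -> R -> R) :
  (forall i, P i -> ac s t (y i)) ->
  ac s t (fun x => \sum_(i <- r | P i) y i x).
Proof.
move=> acy; elim: r => [|i r ih].
  rewrite (_ : (fun _ => _) = fun=> 0); first exact: ac_cst.
  by apply/funext => x; rewrite big_nil.
have [Pi|Pi] := boolP (P i); last first.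
  rewrite (_ : (fun _ => _) = fun x => \sum_(j <- r | P j) y j x) //.
  by apply/funext => x; rewrite big_cons (negbTE Pi).
rewrite (_ : (fun _ => _) = fun x => y i x + \sum_(j <- r | P j) y j x).
  exact: acD (acy _ Pi) ih.
by apply/funext => x; rewrite big_cons Pi.
Qed.

Lemma ac_continuous (R : realType) (s t : R) y : ac s t y ->
  {within `[s, t], continuous y}.
Proof.
move=> acy; apply/subspace_continuousP => x /=; rewrite in_itv/= => /andP[sx xt].
apply/cvgrPdist_lt => e /acy[d d0 H].
have key u v : s <= u -> u <= v -> v <= t -> v - u < d -> `|y v - y u| < e.
  move=> su uv vt uvd; have := H [:: (u, v)].
  by rewrite /chain !big_seq1/= su uv vt/=; apply.
rewrite near_withinE; exists d => //= z /= xz; rewrite in_itv/= => /andP[sz zt].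
have [zx|/ltW zx] := leP z x.
  by apply: key => //; rewrite -[_ - _]ger0_norm ?subr_ge0.
by rewrite distrC; apply: key => //; rewrite -[_ - _]ger0_norm ?subr_ge0// distrC.
Qed.

Lemma ac_max (R : realType) (s t : R) y : s <= t -> ac s t y ->
  exists2 c, s <= c <= t & forall x, s <= x <= t -> y x <= y c.
Proof.
move=> st /ac_continuous/(EVT_max st)[c cst H].
by exists c; [move: cst; rewrite in_itv|move=> x xst; apply: H; rewrite in_itv].
Qed.

Lemma ac_bounded (R : realType) (s t : R) y : ac s t y ->
  exists2 M, 0 <= M & forall x, s <= x <= t -> `|y x| <= M.
Proof.
move=> acy; have [st|ts] := leP s t; last first.
  exists 0 => // x /andP[sx xt].
  by move: (le_lt_trans (le_trans sx xt) ts); rewrite ltxx.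
have [c _ H] := ac_max st acy.
have [c' _ H'] := ac_max st (@acZ _ _ _ (-1) _ acy).
exists (`|y c| + `|y c'|); first by rewrite addr_ge0.
move=> x xst; have := H _ xst; have := H' _ xst; rewrite !mulN1r lerN2 => h1 h2.
have := ler_norm (- y c'); have := ler_norm (y c); rewrite normrN => n1 n2.
have p1 := normr_ge0 (y c); have p2 := normr_ge0 (y c').
by rewrite ler_norml; apply/andP; split; lra.
Qed.

Lemma acM (R : realType) (s t : R) y z :
  ac s t y -> ac s t z -> ac s t (fun x => y x * z x).
Proof.
move=> acy acz; have [M M0 HM] := ac_bounded acy; have [N N0 HN] := ac_bounded acz.
apply: (@ac_dominated _ _ _ (M + N) y z) => // u v su uv vt.
have -> : y v * z v - y u * z u = y v * (z v - z u) + z u * (y v - y u) by ring.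
rewrite (le_trans (ler_normD _ _))// !normrM.
have Mv := HM v; have Nu := HN u.
rewrite su vt (le_trans uv vt) (le_trans su uv) in Mv Nu.
move: (Mv isT) (Nu isT) => {}Mv {}Nu.
have h1 : `|y v| * `|z v - z u| <= M * `|z v - z u| by rewrite ler_wpM2r.
have h2 : `|z u| * `|y v - y u| <= N * `|y v - y u| by rewrite ler_wpM2r.
have h3 : 0 <= N * `|z v - z u| by rewrite mulr_ge0.
have h4 : 0 <= M * `|y v - y u| by rewrite mulr_ge0.
by lra.
Qed.

Lemma ac_expR (R : realType) (s t : R) y : ac s t y ->
  ac s t (fun x => expR (y x)).
Proof.
move=> acy; have [M M0 HM] := ac_bounded acy.
have key a b : a <= b -> b <= M -> `|expR b - expR a| <= expR M * `|b - a|.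
  move=> ab bM; rewrite !ger0_norm ?subr_ge0 ?ler_expR//.
  have h : expR b - expR a <= expR b * (b - a).
    have -> : expR a = expR b * expR (a - b) by rewrite -expRD addrC subrK.
    have := expR_ge1Dx (a - b); have := expR_gt0 b => b0 h.
    by rewrite -[X in X - _]mulr1 -mulrBr ler_pM2l//; lra.
  by rewrite (le_trans h)// ler_wpM2r ?subr_ge0// ler_expR.
apply: (@ac_dominated _ _ _ (expR M) y y) => // u v su uv vt.
have Mv : y v <= M.
  by apply: le_trans (ler_norm _) (HM _ _); rewrite (le_trans su uv).
have Mu : y u <= M.
  by apply: le_trans (ler_norm _) (HM _ _); rewrite su (le_trans uv).
apply: (@le_trans _ _ (expR M * `|y v - y u|)).
  have [uv'|/ltW vu'] := leP (y u) (y v); first exact: key.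
  by rewrite distrC (distrC (y v)); exact: key.
by rewrite ler_wpM2l ?expR_ge0// lerDl.
Qed.

Lemma chain_rcons (R : realType) (s u v : R) l : s <= u -> u <= v ->
  chain s u l -> chain s v (rcons l (u, v)).
Proof.
move=> su uv /andP[al pl]; rewrite /chain all_rcons pairwise_rcons pl/= su uv lexx !andbT/=.
apply/andP; split; apply: sub_all al => p /andP[/andP[p1 p2] p3] //.
by rewrite p1 p2 (le_trans p3).
Qed.

Lemma chainS (R : realType) (s u v : R) l : u <= v -> chain s u l -> chain s v l.
Proof.
move=> uv /andP[al pl]; rewrite /chain pl andbT; apply: sub_all al.
by move=> p /andP[/andP[-> ->] p3]; exact: le_trans uv.
Qed.

(** A Cousin-type covering argument.  Given e, cover the null set N by an open U
    whose measure is below the modulus of absolute continuity of z for e, and move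
    from s to the right.  At a point outside N a short step costs at most e times
    its length; a short step across a point of N lies in U and is recorded in a
    list of intervals.  The supremum of the reachable points is t, and the total
    variation along the recorded intervals is below e because their total length
    is at most the measure of U. *)
Lemma ac_nondecreasing (R : realType) (s t : R) z (N : set R) : s <= t ->
  ac s t z -> (@lebesgue_measure R).-negligible N ->
  (forall x, s <= x -> x <= t -> ~ N x -> forall e : R, 0 < e -> exists2 d : R, 0 < d &
    forall u v, s <= u -> u <= x -> x <= v -> v <= t -> v - u < d ->
      - (e * (v - u)) <= z v - z u) ->
  z s <= z t.
Proof.
move=> st acz N0 H; apply/ler_addgt0Pr => e0 e00.
pose e := e0 / (t - s + 1).
have ts1 : 0 < t - s + 1 by rewrite ltr_wpDl ?subr_ge0.
have egt0 : 0 < e by rewrite divr_gt0.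
have [d dgt0 acd] := acz _ egt0.
have d2 : 0 < d / 2 by rewrite divr_gt0.
have [U [oU NU muU]] := outer_measure_open_le N d2.
have {}muU : (lebesgue_measure U < d%:E)%E.
  apply: (le_lt_trans muU); move/negligible_outer_measure : N0 => ->.
  by rewrite add0e lte_fin ltr_pdivrMr// mulr_natr mulr2n ltrDl.
have mU : measurable (U : set (measurableTypeR R)) by exact: open_measurable.
pose P x := (s <= x <= t) /\ exists l, [/\ chain s x l,
  ((\sum_(p <- l) (p.2 - p.1))%:E <= lebesgue_measure (U `&` `[s, x[%classic))%E &
  z s - e * (x - s) - \sum_(p <- l) `|z p.2 - z p.1| <= z x].
have stepU u v : P u -> u <= v -> v <= t -> `[u, v[%classic `<=` U -> P v.
  move=> [/andP[su ut] [l [cl ml zl]]] uv vt uvU.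
  split; first by rewrite (le_trans su).
  exists (rcons l (u, v)); split; first exact: chain_rcons.
    have -> : U `&` `[s, v[%classic = (U `&` `[s, u[%classic) `|` `[u, v[%classic.
      apply/seteqP; split=> x /=; rewrite !in_itv/=.
        by move=> [Ux /andP[-> ->]]; have [xu|ux] := ltP x u; [left|right].
      move=> [[Ux /andP[-> xu]]|/andP[ux xv]]; first by rewrite (lt_le_trans xu).
      by rewrite xv (le_trans su ux); split => //; apply: uvU; rewrite /= in_itv/= ux.
    rewrite measureU//=; last 2 first.
      exact: measurableI.
      apply/seteqP; split=> x //=; rewrite !in_itv/= => -[[_ /andP[_ xu]] /andP[ux _]].
      by move: (lt_le_trans xu ux); rewrite ltxx.
    rewrite big_rcons/= EFinD leeD// lebesgue_measure_itv/= lte_fin.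
    by case: ltP => // vu; rewrite lee_fin subr_le0.
  rewrite big_rcons/=; have := ler_norm (z u - z v); rewrite distrC => h.
  have h2 : 0 <= e * (v - u) by rewrite mulr_ge0 ?subr_ge0// ltW.
  by lra.
have stepz u v : P u -> u <= v -> v <= t -> - (e * (v - u)) <= z v - z u -> P v.
  move=> [/andP[su ut] [l [cl ml zl]]] uv vt uvz.
  split; first by rewrite (le_trans su).
  exists l; split; first exact: chainS cl.
    apply: (le_trans ml); apply: le_measure; rewrite ?inE; try exact: measurableI.
    by move=> x /= [? ]; rewrite !in_itv/= => /andP[-> xu]; rewrite (lt_le_trans xu).
  by lra.
have Ps : P s.
  split; first by rewrite lexx.
  by exists [::]; rewrite !big_nil subrr mulr0 !subr0.
suff [_ [l [cl ml zl]]] : P t.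
  have : \sum_(p <- l) (p.2 - p.1) < d.
    rewrite -lte_fin (le_lt_trans ml)// (le_lt_trans _ muU)//.
    by apply: le_measure; rewrite ?inE//; exact: measurableI.
  move/(acd _ cl) => h; have -> : e0 = e * (t - s) + e.
    by rewrite /e; field; rewrite gt_eqF.
  by lra.
have hsE : has_sup [set x | P x].
  by split; [exists s | exists t => x [/andP[]]].
set c := sup [set x | P x].
have sc : s <= c by apply: ub_le_sup => //; exact: hsE.2.
have ct : c <= t by apply: ge_sup => //; [exists s|move=> x [/andP[]]].
have [dl dl0 step] : exists2 dl, 0 < dl & forall u v, P u -> u <= c -> c <= v -> v <= t ->
    v - u < dl -> P v.
  have [Nc|Nc] := pselect (N c).
    have /nbhs_ballP[dl /= dl0 bU] : nbhs c U by apply: open_nbhs_nbhs; split => //; exact: NU.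
    exists dl => // u v Pu uc cv vt uv; apply: (stepU u) => //; first exact: le_trans cv.
    move=> x /=; rewrite in_itv/= => /andP[ux xv]; apply: bU.
    by rewrite /ball/= ltr_norml; apply/andP; split; lra.
  have [dl dl0 Hd] := H _ sc ct Nc _ egt0.
  exists dl => // u v Pu uc cv vt uv; apply: (stepz u) => //; first exact: le_trans cv.
  by apply: Hd => //; case: Pu => /andP[].
have [u Pu cu] := sup_adherent (divr_gt0 dl0 (ltr0n R 2)) hsE.
have uc : u <= c by apply: ub_le_sup => //; exact: hsE.2.
rewrite -/c in cu.
pose v := Num.min t (c + dl / 4).
have vt : v <= t by rewrite /v ge_min lexx.
have cv : c <= v by rewrite /v le_min ct lerDl divr_ge0// ltW.
have Pv : P v.
  apply: (step u) => //.
  have : v <= c + dl / 4 by rewrite /v ge_min lexx orbT.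
  by lra.
have vc : v <= c by apply: ub_le_sup => //; exact: hsE.2.
suff -> : t = v by [].
apply/eqP; rewrite eq_le vt andbT; move: vc; rewrite /v ge_min le_min lexx/=.
by case/orP => [tc|]; [rewrite (le_trans tc)// lerDl divr_ge0// ltW|lra].
Qed.

(** * Primitives and a differential inequality *)

Lemma is_derive_lower (R : realType) (z : R -> R) (x D : R) :
  is_derive (x : R^o) (1 : R^o) z D -> 0 <= D ->
  forall e : R, 0 < e -> exists2 d : R, 0 < d & forall u v, u <= x -> x <= v ->
    v - u < d -> - (e * (v - u)) <= z v - z u.
Proof.
move=> [dz zD] D0 e e0.
have : h^-1 *: (z (h + x) - z x) @[h --> 0^'] --> D.
  rewrite -zD; suff <- : (fun h : R => h^-1 *: ((z \o shift x) (h *: (1 : R^o)) - z x)) =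
    (fun h => h^-1 *: (z (h + x) - z x)) by exact: dz.
  by apply/funext => h /=; rewrite /GRing.scale/= mulr1.
move/cvgrPdist_lt => /(_ _ e0)[d /= d0 H].
have slope h : h != 0 -> `|h| < d -> - e <= h^-1 * (z (h + x) - z x).
  move=> h0 hd; have := H h; rewrite /= sub0r normrN => /(_ hd h0).
  by rewrite ltr_norml => /andP[_]; rewrite /GRing.scale/=; lra.
exists d => // u v ux xv uvd.
have hv : - (e * (v - x)) <= z v - z x.
  have [->|xv'] := eqVneq v x; first by rewrite !subrr mulr0 oppr0.
  have vx0 : 0 < v - x by rewrite subr_gt0 lt_neqAle eq_sym xv'.
  have := slope (v - x); rewrite gt_eqF// gtr0_norm// subrK => /(_ isT).
  have vd : v - x < d by lra.
  move/(_ vd); rewrite -(ler_pM2l vx0) mulrA divff ?gt_eqF// mul1r; lra.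
have hu : - (e * (x - u)) <= z x - z u.
  have [->|ux'] := eqVneq u x; first by rewrite !subrr mulr0 oppr0.
  have vx0 : 0 < x - u by rewrite subr_gt0 lt_neqAle ux'.
  have vd : x - u < d by lra.
  have := slope (u - x); rewrite -oppr_eq0 opprB gt_eqF// distrC gtr0_norm// subrK.
  have inv : (x - u) * (u - x)^-1 = -1.
    by rewrite -(opprB x u) invrN mulrN divff// gt_eqF.
  by move=> /(_ isT vd); rewrite -(ler_pM2l vx0) mulrA inv; lra.
by lra.
Qed.

#[local] Instance lebesgue_ae_filter (R : realType) :
  Filter (nbhs (almost_everywhere (@lebesgue_measure R))).
Proof. exact: ae_filter_ringOfSetsType. Qed.

Lemma ae_nondecreasing (R : realType) (s t : R) z : s <= t -> ac s t z ->
  {ae (@lebesgue_measure R), forall x, s <= x -> x <= t ->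
     exists2 D, is_derive (x : R^o) (1 : R^o) z D & 0 <= D} ->
  z s <= z t.
Proof.
move=> st acz aez; apply: (ac_nondecreasing st acz aez) => x sx xt.
move=> /contrapT/(_ sx xt)[D zD D0] e /(is_derive_lower zD D0)[d d0 H].
by exists d => // u v su ux xv vt uv; exact: H.
Qed.

(** Only this interface to the integrals of the weights is used by the
    differential inequalities. *)
Definition primitive (R : realType) (g G : R -> R) :=
  (forall s t, ac s t G) /\ {ae (@lebesgue_measure R), forall x, 0 <= x ->
     is_derive (x : R^o) (1 : R^o) G (g x)}.

Lemma primitiveZ (R : realType) (c : R) g G :
  primitive g G -> primitive (fun x => c * g x) (fun x => c * G x).
Proof.
move=> [acG aeG]; split=> [s t|]; first exact: acZ.
apply: filterS aeG => x + x0 => /(_ x0) dG.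
exact: is_deriveZ.
Qed.

Lemma primitive0 (R : realType) : primitive (fun=> 0 : R) (fun=> 0).
Proof.
split=> [s t|]; first exact: ac_cst.
by apply: aeW => x _; exact: is_derive_cst.
Qed.

Lemma primitive_sum (R : realType) (I : Type) (r : seq I) (P : pred I)
    (g G : I -> R -> R) : (forall i, P i -> primitive (g i) (G i)) ->
  primitive (fun x => \sum_(i <- r | P i) g i x) (fun x => \sum_(i <- r | P i) G i x).
Proof.
move=> pG; split=> [s t|]; first by apply: ac_sum => i /pG[].
elim: r => [|i r ih].
  rewrite (_ : (fun x => _) = fun=> 0); last by apply/funext => x; rewrite big_nil.
  by apply: aeW => x _; rewrite big_nil; exact: is_derive_cst.
have [Pi|Pi] := boolP (P i); last first.
  rewrite (_ : (fun x => _) = (fun x => \sum_(i <- r | P i) G i x)).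
    by apply: filterS ih => x; rewrite big_cons (negbTE Pi).
  by apply/funext => x; rewrite big_cons (negbTE Pi).
rewrite (_ : (fun x => _) = G i + (fun x => \sum_(i <- r | P i) G i x)).
  apply: filterS2 ih (pG _ Pi).2 => x h1 h2 x0; rewrite big_cons Pi.
  by apply: is_deriveD; [exact: h2|exact: h1].
by apply/funext => x; rewrite big_cons Pi.
Qed.

Lemma primitive_nondecreasing (R : realType) (g G : R -> R) :
  (forall x, 0 <= x -> 0 <= g x) -> primitive g G ->
  forall s t, 0 <= s -> s <= t -> G s <= G t.
Proof.
move=> g0 [acG aeG] s t s0 st; apply: ae_nondecreasing => //.
apply: filterS aeG => x dG sx xt; have x0 := le_trans s0 sx.
by exists (g x); [exact: dG|exact: g0].
Qed.

(** Multiply by the integrating factor: z = y exp(A - A(s)) - B is absolutely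
    continuous, and z' >= beta (exp(A - A(s)) - 1) >= 0 almost everywhere since A is
    nondecreasing.  Hence z(s) <= z(t), which is the claim up to the factor
    exp(A(s) - A(t)). *)
Lemma comparison (R : realType) (alpha A beta B y : R -> R) (s t : R) :
  (forall x, 0 <= x -> 0 <= alpha x) -> primitive alpha A ->
  (forall x, 0 <= x -> 0 <= beta x) -> primitive beta B ->
  0 <= s -> s <= t -> ac s t y -> (forall x, s <= x -> x <= t -> 0 <= y x) ->
  {ae (@lebesgue_measure R), forall x, s <= x -> x <= t ->
     exists2 D, is_derive (x : R^o) (1 : R^o) y D & beta x - alpha x * y x <= D} ->
  expR (A s - A t) * (y s + (B t - B s)) <= y t.
Proof.
move=> a0 pA b0 pB s0 st acy y0 dy.
pose z x := y x * expR (A x - A s) - B x.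
have acz : ac s t z.
  apply: acB (pB.1 s t); apply: acM => //; apply: ac_expR; apply: acB => //.
    exact: pA.1.
  exact: ac_cst.
have : z s <= z t.
  apply: ae_nondecreasing => //.
  apply: filterS3 dy pA.2 pB.2 => x dy dA dB sx xt.
  have x0 := le_trans s0 sx; have [D yD Dge] := dy sx xt.
  have {}dA := dA x0; have {}dB := dB x0.
  pose E := expR (A x - A s).
  have dE : is_derive (x : R^o) (1 : R^o) (expR \o (fun x => A x - A s)) (E * (alpha x - 0)).
    have dA' : is_derive (x : R^o) (1 : R^o) (fun x => A x - A s) (alpha x - 0).
      exact: (is_deriveB (f := A) (g := cst (A s))).
    exact: (is_derive1_comp (f := expR)).
  exists ((y x *: (E * (alpha x - 0)) + E *: D) - beta x).
      exact: (is_deriveB (f := y * (expR \o (fun x => A x - A s))) (g := B)).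
  rewrite /GRing.scale/= subr0.
  have E1 : 1 <= E.
    by rewrite /E -expR0 ler_expR subr_ge0; apply: (primitive_nondecreasing _ pA).
  have := b0 _ x0; have : 0 <= E * (D - (beta x - alpha x * y x)).
    by rewrite mulr_ge0 ?subr_ge0// (le_trans _ E1).
  have : 0 <= (E - 1) * beta x by rewrite mulr_ge0 ?subr_ge0// b0.
  by lra.
rewrite /z subrr expR0 mulr1 => h.
have -> : y t = expR (A s - A t) * (y t * expR (A t - A s)).
  by rewrite mulrCA -expRD addrA subrK subrr expR0 mulr1.
by rewrite ler_pM2l ?expR_gt0//; lra.
Qed.

(** * Indefinite integrals with respect to the completed Lebesgue measure *)

(** Both measures are restrictions of the same outer measure. *)
Lemma leb_negligible (R : realType) (N : set R) :
  (@leb R).-negligible N -> (@lebesgue_measure R).-negligible N.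
Proof.
move=> [A [mA A0 NA]]; apply/negligible_outer_measure/eqP.
by rewrite eq_le outer_measure_ge0 andbT -[leRHS]A0; exact: le_outer_measure.
Qed.

Lemma lebesgue_borelP (R : realType) (A : set (lebesgueTypeR R)) :
  measurable A -> exists B N : set (measurableTypeR R),
    [/\ measurable B, (@lebesgue_measure R).-negligible N & A = B `|` N].
Proof.
rewrite /measurable/= => mA.
have : (completed_algebra_gen (@lebesgue_measure R)).-sigma.-measurable A.
  by rewrite completed_caratheodory_measurable.
by rewrite g_sigma_completed_algebra_genE => -[B mB [N nN BN]]; exists B, N.
Qed.

(** For each rational q the level set [f > q] is the union of a Borel set and a
    null set.  Outside a Borel null set N that contains these countably many null
    sets, all level sets of f are countable unions of the Borel parts, so setting f
    to 0 on N makes it Borel measurable. *)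
Lemma borel_version (R : realType) (f : R -> R) :
  lebesgue_measurable_fun [set: R] f ->
  exists N : set (measurableTypeR R),
    [/\ measurable N, lebesgue_measure N = 0%E &
        measurable_fun [set: measurableTypeR R] (f \_ (~` N) : _ -> R)].
Proof.
move=> mf; pose q (n : nat) : R := ratr (odflt 0%Q (unpickle n : option rat)).
have /choice[BN HBN] : forall n, exists BN : set (measurableTypeR R) * set (measurableTypeR R),
    [/\ measurable BN.1, (@lebesgue_measure R).-negligible BN.2 &
      f @^-1` `]q n, +oo[ = BN.1 `|` BN.2].
  move=> n; have : measurable (f @^-1` `]q n, +oo[ : set (lebesgueTypeR R)).
    by rewrite -[X in measurable X]setTI; apply: mf => //; exact: measurable_itv.
  by move=> /lebesgue_borelP[B [N H]]; exists (B, N).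
have : (@lebesgue_measure R).-negligible (\bigcup_n (BN n).2).
  by apply: negligible_bigcup => n; have [] := HBN n.
move=> [N [mN N0 subN]]; exists N; split => //.
have key r : (~` N) `&` (f @^-1` `]r, +oo[) =
    (~` N) `&` \bigcup_(n in [set n | r < q n]) (BN n).1.
  apply/seteqP; split=> x [Nx] /=; rewrite ?in_itv/= ?andbT => H; split => //=.
    have [s] := rat_in_itvoo H; rewrite in_itv/= => /andP[rs sf].
    have qs : q (pickle s) = ratr s by rewrite /q pickleK.
    exists (pickle s); rewrite /= ?qs//.
    have [_ _ E] := HBN (pickle s).
    have : (f @^-1` `]q (pickle s), +oo[) x by rewrite /= in_itv/= qs sf.
    by rewrite E => -[//|BNx]; exfalso; apply: Nx; apply: subN; exists (pickle s).
  case: H => n /= rq Bx; have [_ _ E] := HBN n.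
  have : (f @^-1` `]q n, +oo[) x by rewrite E; left.
  by rewrite /= in_itv/= andbT; exact: lt_trans.
have mkey r : measurable ((~` N) `&` (f @^-1` `]r, +oo[) : set (measurableTypeR R)).
  rewrite key; apply: measurableI; first exact: measurableC.
  by apply: bigcup_measurable => n _; have [] := HBN n.
apply: (measurability _ (RGenOInfty.measurableE R)) => _ [_ [r ->] <-].
rewrite setTI; have [r0|r0] := ltP r 0.
  rewrite (_ : _ @^-1` _ = ((~` N) `&` (f @^-1` `]r, +oo[)) `|` N).
    exact: measurableU.
  apply/seteqP; split=> x /=; rewrite !in_itv/= !andbT patchE.
    case: ifPn => [/set_mem Nx|/negP Nx _]; [by left|right].
    by apply: contrapT => H; apply: Nx; exact: mem_set.
  move=> [[Nx]|Nx]; first by rewrite mem_set.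
  by rewrite memNset// => -[].
rewrite (_ : _ @^-1` _ = ((~` N) `&` (f @^-1` `]r, +oo[)))//.
apply/seteqP; split=> x /=; rewrite !in_itv/= !andbT patchE.
  by case: ifPn => [/set_mem Nx//|_ /=]; rewrite ltNge r0.
by move=> [Nx]; rewrite mem_set.
Qed.

Lemma leb_ae (R : realType) (P : R -> Prop) :
  {ae (@leb R), forall x, P x} -> {ae (@lebesgue_measure R), forall x, P x}.
Proof. exact: leb_negligible. Qed.

(** The Borel measure is the image of the completed one under the identity map,
    which is measurable from the larger sigma-algebra to the smaller one. *)
Lemma ge0_integral_leb (R : realType) (D : set (measurableTypeR R)) (f : R -> \bar R) :
  measurable D -> measurable_fun (D : set (measurableTypeR R)) f ->
  (forall x, D x -> (0 <= f x)%E) ->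
  (\int[leb]_(x in D) f x = \int[lebesgue_measure]_(x in D) f x)%E.
Proof.
move=> mD mf f0; pose phi : lebesgueTypeR R -> measurableTypeR R := fun x => x.
have mphi : measurable_fun [set: lebesgueTypeR R] phi.
  by move=> _ Y mY; rewrite setTI; exact: sub_caratheodory.
transitivity (\int[pushforward (@leb R) phi]_(y in D) f y)%E.
  by rewrite ge0_integral_pushforward// => x /set_mem; exact: f0.
by apply: eq_measure_integral.
Qed.

Lemma locally_integrable_measurable (R : realType) (g : R -> R) :
  locally_lebesgue_integrable g ->
  lebesgue_measurable_fun [set: R] (g \_ `[0, +oo[).
Proof.
move=> ig.
have mI (i : interval R) : measurable ([set` i] : set (lebesgueTypeR R)).
  by apply: sub_caratheodory; exact: measurable_itv.
apply/(measurable_restrictT _ _).1 => //.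
have -> : `[0%R, +oo[%classic = \bigcup_n `[0%R, n%:R : R]%classic.
  apply/seteqP; split=> x /=; rewrite in_itv/= ?andbT.
    move=> x0; exists (Num.bound x) => //=; rewrite in_itv/= x0 ltW//.
    by have := archi_boundP x0.
  by move=> [n _]; rewrite /= in_itv/= => /andP[].
apply/measurable_fun_bigcup => // n.
by have /integrableP[/measurable_EFinP] := ig _ (ler0n R n).
Qed.

(** A Borel substitute gB for a rate g on the half-line, extended by 0 to the
    left so that it can be integrated over left-unbounded intervals. *)
Record borel_rate (R : realType) (g gB : R -> R) : Prop := Rate {
  rate_meas : measurable_fun [set: measurableTypeR R] (gB : measurableTypeR R -> R) ;
  rate_ge0 : forall x, 0 <= gB x ;
  rate_int : forall T : R, lebesgue_measure.-integrable `]-oo, T] (EFin \o gB) ;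
  rate_ae : {ae (@lebesgue_measure R), forall x, 0 <= x -> gB x = g x} ;
  rate_eq : forall s t : R, 0 <= s ->
    (\int[leb]_(x in `[s, t]) (g x)%:E = \int[lebesgue_measure]_(x in `[s, t]) (gB x)%:E)%E }.

Lemma borel_rate_exists (R : realType) (g : R -> R) :
  (forall x, 0 <= x -> 0 <= g x) -> locally_lebesgue_integrable g ->
  exists gB, borel_rate g gB.
Proof.
move=> g0 ig; have mf := locally_integrable_measurable ig.
have [N [mN N0 mfN]] := borel_version mf.
set f := g \_ `[0, +oo[ in mf mfN.
have f0 x : 0 <= f x.
  rewrite /f patchE; case: ifPn => // /set_mem /=; rewrite in_itv/= andbT; exact: g0.
have fg x : 0 <= x -> f x = g x.
  by move=> x0; rewrite /f patchE mem_set//= in_itv/= x0.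
have fneg x : x < 0 -> f x = 0.
  by move=> x0; rewrite /f patchE memNset//= in_itv/= leNgt x0.
pose gB := f \_ (~` N).
have gB0 x : 0 <= gB x by rewrite /gB patchE; case: ifP.
have gBf x : ~ N x -> gB x = f x by move=> Nx; rewrite /gB patchE mem_set.
have eqst (s t : R) : 0 <= s ->
    (\int[leb]_(x in `[s, t]) (g x)%:E = \int[lebesgue_measure]_(x in `[s, t]) (gB x)%:E)%E.
  move=> s0; rewrite -ge0_integral_leb//=; last 2 first.
    by apply/measurable_EFinP; exact: measurable_funTS.
    by move=> x _; rewrite lee_fin.
  transitivity (\int[leb]_(x in `[s, t]) (f x)%:E)%E.
    apply: eq_integral => x; rewrite inE/= in_itv/= => /andP[sx _].
    by rewrite fg// (le_trans s0).
  have mst : measurable (`[s, t]%classic : set (lebesgueTypeR R)).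
    by apply: sub_caratheodory; exact: measurable_itv.
  apply: ge0_ae_eq_integral => //=.
  - by apply/measurable_EFinP; exact: measurable_funTS.
  - apply/measurable_EFinP; apply: measurable_funTS => _ Y mY.
    by apply: sub_caratheodory; exact: mfN.
  - by move=> x _; rewrite lee_fin.
  - by move=> x _; rewrite lee_fin.
  exists N; split => //; first exact: sub_caratheodory.
  move=> x /= H; apply: contrapT => Nx; apply: H => _.
  by rewrite gBf.
exists gB; split => //.
- move=> T; apply/integrableP; split.
    by apply/measurable_EFinP; exact: measurable_funTS.
  rewrite (_ : (fun x => _) = (EFin \o gB)); last first.
    by apply/funext => x /=; rewrite ger0_norm.
  pose M := Num.max T 0; have M0 : 0 <= M by rewrite /M le_max lexx orbT.
  apply: (@le_lt_trans _ _ (\int[lebesgue_measure]_(x in `]-oo, M]) (gB x)%:E)%E).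
    apply: ge0_subset_integral => //=.
    - by apply/measurable_EFinP; exact: measurable_funTS.
    - by move=> x _; rewrite lee_fin.
    - by apply: subset_itvl; rewrite bnd_simp /M le_max lexx.
  suff -> : (\int[lebesgue_measure]_(x in `]-oo, M]) (gB x)%:E =
             \int[lebesgue_measure]_(x in `[0%R, M]) (gB x)%:E)%E.
    rewrite -eqst//; apply: (@integrable_lty _ _ _ (@leb R)) (ig _ M0).
    by apply: sub_caratheodory; exact: measurable_itv.
  rewrite integral_mkcond [RHS]integral_mkcond; apply: eq_integral => x _.
  rewrite !patchE !mem_setE !in_itv/=.
  have [//|x0] := leP 0 x; case: ifP => // _.
  by rewrite /gB patchE fneg//; case: ifP.
- exists N; split => // x /= /not_implyP[x0 H].
  by apply: contrapT => Nx; apply: H; rewrite gBf// fg.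
Qed.

Definition cumul (R : realType) (gB : R -> R) (x : R) : R :=
  (\int[lebesgue_measure]_(t in `]-oo, x]) gB t)%R.

Section cumul.
Variables (R : realType) (g gB : R -> R).
Hypothesis gBP : borel_rate g gB.

Lemma cumulB u v : u <= v ->
  cumul gB v - cumul gB u = (\int[lebesgue_measure]_(t in `]u, v]) gB t)%R.
Proof.
by move=> uv; apply: Rintegral_itvB; [exact: (rate_int gBP)|rewrite bnd_simp..].
Qed.

Lemma rate_integrable (D : set (measurableTypeR R)) T :
  measurable D -> D `<=` `]-oo, T] ->
  lebesgue_measure.-integrable D (EFin \o gB).
Proof. by move=> mD DT; apply: integrableS (rate_int gBP T). Qed.

(** The increments along a chain add up to the integral over the union of its
    intervals, which turns absolute continuity of the integral as a set function
    into absolute continuity of the indefinite integral. *)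
Lemma cumul_chain s t l : chain s t l ->
  exists D : set (measurableTypeR R), [/\ measurable D, D `<=` `]s, t],
    (lebesgue_measure D <= (\sum_(p <- l) (p.2 - p.1))%:E)%E &
    \sum_(p <- l) `|cumul gB p.2 - cumul gB p.1| =
    (\int[lebesgue_measure]_(x in D) gB x)%R].
Proof.
elim: l s => [|[u v] l ih] s.
  by exists set0; split => //; rewrite ?measure0 ?big_nil ?Rintegral_set0.
rewrite /chain/= => /andP[/andP[/andP[/andP[su uv] vt] al] /andP[pv pl]].
have /ih[D [mD Dvt muD sumD]] : chain v t l.
  rewrite /chain pl andbT; apply/allP => p pl'.
  by move: (allP al _ pl') (allP pv _ pl') => /andP[/andP[_ ->] ->] ->.
have mI : measurable (`]u, v]%classic : set (measurableTypeR R)).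
  exact: measurable_itv.
exists (`]u, v]%classic `|` D); split.
- exact: measurableU.
- move=> x /= [|/Dvt/=]; rewrite !in_itv/= => /andP[h1 h2].
    by rewrite (le_lt_trans su h1) (le_trans h2 vt).
  by rewrite h2 (le_lt_trans (le_trans su uv) h1).
- apply: (le_trans (measureU2 _ mI mD)).
  rewrite big_cons EFinD leeD//= lebesgue_measure_itv/= lte_fin.
  by case: ifPn => // _; rewrite lee_fin subr_ge0.
rewrite big_cons sumD/= Rintegral_setU//.
- rewrite -cumulB// ger0_norm// cumulB//; apply: Rintegral_ge0 => x _.
  exact: (rate_ge0 gBP).
- apply: (@rate_integrable _ t).
    by apply: measurableU => //; exact: measurable_itv.
  by move=> x /= [|/Dvt/=]; rewrite !in_itv/= => /andP[_ h2]//; exact: le_trans vt.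
- apply/disj_setPS => x /= [+ /Dvt/=]; rewrite !in_itv/= => /andP[_ xv] /andP[vx _].
  by move: (lt_le_trans vx xv); rewrite ltxx.
Qed.

Lemma cumul_ac s t : ac s t (cumul gB).
Proof.
move=> e e0.
have : lebesgue_measure.-integrable setT (EFin \o (gB \_ `]-oo, t])).
  by rewrite -restrict_EFin; rewrite -integrable_mkcond//; exact: (rate_int gBP).
move=> /integral_normr_continuous/(_ _ e0)[d [d0 H]].
exists d => // l /cumul_chain[D [mD Dst muD ->]] sd.
have /(H _ mD) : (lebesgue_measure D < d%:E)%E by rewrite (le_lt_trans muD)// lte_fin.
apply: le_lt_trans; rewrite le_eqVlt; apply/orP; left; apply/eqP.
apply: eq_Rintegral => x /set_mem/Dst/=; rewrite in_itv/= => /andP[_ xt].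
by rewrite patchE mem_set//= ger0_norm//; exact: (rate_ge0 gBP).
Qed.

Lemma cumul_primitive : primitive g (cumul gB).
Proof.
split=> [s t|]; first exact: cumul_ac.
have loc : locally_integrable [set: R] gB.
  split; [exact: (rate_meas gBP)|exact: openT|move=> K _ cK].
  have [M [Mreal HM]] := compact_bounded cK.
  have KM : K `<=` `]-oo, M + 1].
    move=> x Kx /=; rewrite in_itv/= (le_trans (ler_norm _))//.
    by apply: HM => //; rewrite ltrDl.
  have mK : measurable (K : set (measurableTypeR R)) by exact: compact_measurable.
  have /integrableP[_] := rate_integrable mK KM.
  exact.
apply: filterS2 (FTC1Ny (rate_int gBP) loc) (rate_ae gBP) => x [dG dGx] gx x0.
by apply: DeriveDef => //; rewrite -derive1E dGx gx.
Qed.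

Lemma integral_cumul s t : 0 <= s -> s <= t ->
  (\int[leb]_(x in `[s, t]) (g x)%:E = (cumul gB t - cumul gB s)%:E)%E.
Proof.
move=> s0 st; rewrite (rate_eq gBP)// cumulB// -integral_itv_obnd_cbnd; last first.
  by apply/measurable_EFinP; apply: measurable_funTS; exact: (rate_meas gBP).
rewrite fineK//; apply: integrable_fin_num => //.
by apply: (@rate_integrable _ t) => // x /=; rewrite !in_itv/= => /andP[].
Qed.

End cumul.

Lemma primitive_exists (R : realType) (g : R -> R) :
  (forall x, 0 <= x -> 0 <= g x) -> locally_lebesgue_integrable g ->
  exists2 G, primitive g G & forall s t, 0 <= s -> s <= t ->
    (\int[leb]_(x in `[s, t]) (g x)%:E = (G t - G s)%:E)%E.
Proof.
move=> g0 ig; have [gB gBP] := borel_rate_exists g0 ig.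
by exists (cumul gB); [exact: cumul_primitive|exact: integral_cumul].
Qed.

(** * Decay for a scalar system of delayed differential inequalities *)

(** A is the matrix of weights, G the matrix of their primitives and h the matrix
    of delays; F is a family of subsolutions indexed by the nodes. *)
Section delayed_inequality.
Variables (R : realType) (N : finType) (A h G : N -> N -> R -> R) (hbar t0 : R).
Variable (F : N -> R -> R).
Hypothesis A_ge0 : forall i j (t : R), 0 <= t -> 0 <= A i j t.
Hypothesis AG : forall i j, primitive (A i j) (G i j).
Hypothesis t0_ge0 : 0 <= t0.
Hypothesis hbar_ge0 : 0 <= hbar.
Hypothesis h_bound : forall i j (t : R), 0 <= t -> 0 <= h i j t <= hbar.
Hypothesis F_ac : forall i T, ac t0 T (F i).
Hypothesis F_sub : {ae (@lebesgue_measure R), forall t : R, t0 <= t -> forall i,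
  exists2 D : R, is_derive (t : R^o) (1 : R^o) (F i) D &
    D <= \sum_(j | j != i) A i j t * (F j (t - h i j t) - F i t)}.

Let inflow i t := \sum_(j | j != i) A i j t.
Let mass i t := \sum_(j | j != i) G i j t.

Lemma mass_mono i (s t : R) : 0 <= s -> s <= t -> mass i s <= mass i t.
Proof.
move=> s0 st; apply: ler_sum => j _.
exact: (primitive_nondecreasing (A_ge0 i j) (AG i j)).
Qed.

(** With y = K - F_i, the delayed inequality reads
    y' >= \sum_(j != i) A_ij (K - F_j(t - h_ij(t))) - inflow_i y. *)
Lemma gap_comparison i (K s t : R) beta B : t0 <= s -> s <= t ->
  (forall x : R, s <= x -> x <= t -> F i x <= K) ->
  (forall x : R, 0 <= x -> 0 <= beta x) -> primitive beta B ->
  (forall x : R, s <= x -> x <= t ->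
     beta x <= \sum_(j | j != i) A i j x * (K - F j (x - h i j x))) ->
  expR (mass i s - mass i t) * (K - F i s + (B t - B s)) <= K - F i t.
Proof.
move=> ts st FK b0 pB bA.
apply: (@comparison _ (inflow i) (mass i) beta B (fun x => K - F i x)) => //.
- by move=> x x0; apply: sumr_ge0 => j _; exact: A_ge0.
- by apply: primitive_sum => j _; exact: AG.
- exact: le_trans ts.
- by apply: acB; [exact: ac_cst|apply: acS (F_ac i t)].
- by move=> x sx xt; rewrite subr_ge0 FK.
apply: filterS F_sub => x Fx sx xt; have [D dF Dle] := Fx (le_trans ts sx) i.
exists (0 - D); first exact: (is_deriveB (f := cst K)).
have := bA x sx xt.
have -> : \sum_(j | j != i) A i j x * (K - F j (x - h i j x)) =
  inflow i x * (K - F i x) - \sum_(j | j != i) A i j x * (F j (x - h i j x) - F i x).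
  rewrite /inflow mulr_suml -sumrB; apply: eq_bigr => j _; ring.
by lra.
Qed.

(** Let S be the largest value reached by any node on [s, x], say by node k at
    time c.  If S > K then the gap S - F_k is positive at time s, hence by
    comparison still positive at time c, where it vanishes. *)
Lemma max_principle (K s : R) : t0 <= s ->
  (forall j (x : R), s - hbar <= x -> x <= s -> F j x <= K) ->
  forall j (x : R), s - hbar <= x -> F j x <= K.
Proof.
move=> ts FK i x sx; have [xs|/ltW sx'] := leP x s; first exact: FK.
have /choice[c Hc] : forall j, exists c, s <= c <= x /\
    forall y, s <= y <= x -> F j y <= F j c.
  move=> j; have [] := @ac_max _ s x (F j) sx'; first exact: acS (F_ac j x).
  by move=> c; exists c.
pose k := [arg max_(j > i) F j (c j)]%O.
have maxk j : F j (c j) <= F k (c k).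
  by rewrite /k; case: arg_maxP => // l _; exact.
have Fx : F i x <= F k (c k).
  by apply: le_trans (maxk i); apply: (Hc i).2; rewrite sx' lexx.
apply: (le_trans Fx); rewrite leNgt; apply/negP => KS.
set S := F k (c k) in maxk Fx KS.
have [/andP[sc cx] _] := Hc k.
have FS j y : s - hbar <= y -> y <= c k -> F j y <= S.
  move=> sy yc; have [ys|/ltW sy'] := leP y s; first by rewrite (le_trans (FK _ _ _ _))// ltW.
  by apply: le_trans (maxk j); apply: (Hc j).2; rewrite sy' (le_trans yc).
have : expR (mass k s - mass k (c k)) * (S - F k s + (0 - 0)) <= S - F k (c k).
  apply: (@gap_comparison k S s (c k) (fun=> 0) (fun=> 0)) => //.
  - by move=> y sy yc; apply: FS => //; rewrite (le_trans _ sy)// lerBlDr lerDl.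
  - exact: primitive0.
  move=> y sy yc; apply: sumr_ge0 => j _.
  have y0 : 0 <= y by rewrite (le_trans t0_ge0)// (le_trans ts).
  have /andP[h0 h1] := h_bound k j y0.
  rewrite mulr_ge0 ?A_ge0// subr_ge0; apply: FS; last by lra.
  by lra.
rewrite subrr addr0 -/S subrr; apply/negP; rewrite -ltNge mulr_gt0 ?expR_gt0// subr_gt0.
by apply: le_lt_trans KS; apply: FK => //; rewrite lerBlDr lerDl.
Qed.

Section below.
Variables (K s : R).
Hypothesis ts : t0 <= s.
Hypothesis FK : forall j (x : R), s - hbar <= x -> F j x <= K.

Lemma gap_persists i (Bd eta u v : R) : s <= u -> u <= v -> 0 <= eta ->
  mass i v - mass i u <= Bd -> F i u <= K - eta ->
  F i v <= K - expR (- Bd) * eta.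
Proof.
move: hbar_ge0 t0_ge0 ts => hb t00 ts' su uv eta0 GB Fu.
have : expR (mass i u - mass i v) * (K - F i u + (0 - 0)) <= K - F i v.
  apply: (@gap_comparison i K u v (fun=> 0) (fun=> 0)) => //.
  - exact: le_trans su.
  - by move=> y sy yc; apply: FK; lra.
  - exact: primitive0.
  move=> y sy yc; apply: sumr_ge0 => j _.
  have y0 : 0 <= y by lra.
  have /andP[h0 h1] := h_bound i j y0.
  by rewrite mulr_ge0 ?A_ge0// subr_ge0; apply: FK; lra.
have : expR (- Bd) * eta <= expR (mass i u - mass i v) * (K - F i u + (0 - 0)).
  by apply: ler_pM => //; rewrite ?expR_ge0 ?ler_expR//; lra.
by lra.
Qed.

(** While j keeps the gap eta, the arc (j, i) contributes at least eta A_ij to the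
    derivative of the gap of i. *)
Lemma gap_spreads i j (Bd eps eta u v : R) : s <= u -> u <= v -> 0 <= eta -> 0 <= eps ->
  j != i -> mass i v - mass i u <= Bd -> eps <= G i j v - G i j u ->
  (forall x : R, u - hbar <= x -> x <= v -> F j x <= K - eta) ->
  F i v <= K - expR (- Bd) * (eta * eps).
Proof.
move: hbar_ge0 t0_ge0 ts => hb t00 ts' su uv eta0 eps0 ji GB Ge Fj.
have : expR (mass i u - mass i v) * (K - F i u + (eta * G i j v - eta * G i j u)) <= K - F i v.
  apply: (@gap_comparison i K u v (fun x => eta * A i j x) (fun x => eta * G i j x)) => //.
  - exact: le_trans su.
  - by move=> y sy yc; apply: FK; lra.
  - by move=> x x0; rewrite mulr_ge0// A_ge0.
  - exact: primitiveZ.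
  move=> y sy yc; have y0 : 0 <= y by lra.
  rewrite (bigD1 j)//= -[leLHS]addr0 lerD//.
    have /andP[h0 h1] := h_bound i j y0.
    have := Fj (y - h i j y); rewrite mulrC => Fjy.
    by rewrite ler_wpM2l ?A_ge0//; have := Fjy ltac:(lra) ltac:(lra); lra.
  apply: sumr_ge0 => l _.
  have /andP[h0 h1] := h_bound i l y0.
  by rewrite mulr_ge0 ?A_ge0// subr_ge0; apply: FK; lra.
have Fu : F i u <= K by apply: FK; lra.
have : expR (- Bd) * (eta * eps) <=
    expR (mass i u - mass i v) * (K - F i u + (eta * G i j v - eta * G i j u)).
  apply: ler_pM; rewrite ?expR_ge0 ?ler_expR ?mulr_ge0//; first by lra.
  have : eta * eps <= eta * (G i j v - G i j u) by rewrite ler_wpM2l.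
  by lra.
by lra.
Qed.

End below.

Variables (Bd eps : R) (tau sigma : nat -> R) (r : N).
Hypothesis Bd_ge0 : 0 <= Bd.
Hypothesis eps_gt0 : 0 < eps.
Hypothesis tau0 : t0 <= tau 0%N.
Hypothesis tau_sigma : forall k, tau k <= sigma k.
Hypothesis sigma_tau : forall k, sigma k + hbar <= tau k.+1.
Hypothesis mass_bound : forall k i, mass i (tau k.+1) - mass i (tau k) <= Bd.
Hypothesis arcs : forall k (S : {set N}), r \in S -> (#|S| < #|N|)%N ->
  exists i j, [/\ i \notin S, j \in S & eps <= G i j (sigma k) - G i j (tau k)].
Hypothesis F_root : forall x, F r x <= 0.

(** The factor kappa collects one loss exp(-Bd) for keeping the gap of the source
    during the window, one for the node that gains it while it builds up, and one
    until the next window. *)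
Let kappa := expR (- Bd) ^+ 3 * Num.min 1 eps.

Lemma kappa_itv : 0 < kappa <= 1.
Proof.
apply/andP; split; first by rewrite mulr_gt0 ?exprn_gt0 ?expR_gt0 ?lt_min ?ltr01.
have h1 : 0 <= Num.min 1 eps <= 1 by rewrite le_min ler01 ltW//= ge_min lexx.
have h2 : 0 <= expR (- Bd) ^+ 3 <= 1.
  by rewrite exprn_ge0 ?expR_ge0//= exprn_ile1 ?expR_ge0// -expR0 ler_expR oppr_le0.
by case/andP: h1 => h1 h1'; case/andP: h2 => h2 h2'; rewrite /kappa mulr_ile1.
Qed.

Lemma tau_ge k : t0 <= tau k.
Proof.
move: hbar_ge0 => hb.
by elim: k => // k ih; have h1 := tau_sigma k; have h2 := sigma_tau k; lra.
Qed.

(** The separation of the windows by hbar makes the gap valid on the whole delay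
    window that ends at the next starting time. *)
Lemma epoch_step (K : R) k (S S' : {set N}) (eta : R) : 0 <= eta ->
  (forall j (x : R), tau k - hbar <= x -> F j x <= K) ->
  (forall j (x : R), j \in S -> tau k - hbar <= x -> x <= tau k -> F j x <= K - eta) ->
  (forall i, i \in S' -> i \in S \/
     exists j, [/\ i \notin S, j \in S & eps <= G i j (sigma k) - G i j (tau k)]) ->
  forall i (x : R), i \in S' -> tau k.+1 - hbar <= x -> x <= tau k.+1 ->
     F i x <= K - kappa * eta.
Proof.
move: hbar_ge0 t0_ge0 Bd_ge0 eps_gt0 => hb t00 Bd0 e00 eta0 FK FS HS i x iS' tx xt.
have ts := tau_sigma k; have st := sigma_tau k; have tk := tau_ge k.
set E := expR (- Bd).
have E0 : 0 < E by rewrite expR_gt0.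
have E1 : E <= 1 by rewrite /E -expR0 ler_expR; lra.
have Gle l u v : tau k <= u -> u <= v -> v <= tau k.+1 -> mass l v - mass l u <= Bd.
  move=> ku uv vk; have := mass_bound k l.
  have h1 : mass l (tau k) <= mass l u by apply: mass_mono => //; lra.
  have h2 : mass l v <= mass l (tau k.+1) by apply: mass_mono => //; lra.
  by lra.
have persist j y : j \in S -> tau k <= y -> y <= tau k.+1 -> F j y <= K - E * eta.
  move=> jS ty yt; apply: (@gap_persists K (tau k) tk FK j Bd eta (tau k) y) => //.
    exact: Gle.
  by apply: FS => //; lra.
have m0 : 0 < Num.min 1 eps by rewrite lt_min ltr01.
have [iS|[j [iS jS Ge]]] := HS i iS'.
  apply: (le_trans (persist i x iS _ xt)); first by lra.
  rewrite lerD2l lerN2 ler_wpM2r// /kappa -/E.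
  have : E ^+ 3 * Num.min 1 eps <= E ^+ 3 * 1.
    by rewrite ler_pM2l ?exprn_gt0// ge_min lexx.
  have : E ^+ 3 <= E by rewrite -[leRHS]expr1; apply: ler_wiXn2l => //; exact: ltW.
  by lra.
have ji : j != i by apply: contraNneq iS => <-.
have Fs : F i (sigma k) <= K - E * (E * eta * eps).
  apply: (@gap_spreads K (tau k) tk FK i j Bd eps (E * eta) (tau k)) => //.
  - by rewrite mulr_ge0// ltW.
  - exact: ltW.
  - by apply: Gle => //; lra.
  move=> y y1 y2; have [yt|/ltW ty] := leP y (tau k); last by apply: persist => //; lra.
  apply: (le_trans (FS j y jS y1 yt)).
  have : E * eta <= 1 * eta by rewrite ler_wpM2r.
  by lra.
have := @gap_persists K (tau k) tk FK i Bd (E * (E * eta * eps)) (sigma k) x ts.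
have e0 : 0 <= E * (E * eta * eps) by rewrite !mulr_ge0// ltW.
move=> /(_ ltac:(lra) e0 (Gle _ _ _ _ _ _) Fs) => /(_ ts ltac:(lra) xt) Fx.
apply: (le_trans Fx); rewrite lerD2l lerN2 -/E.
have : E ^+ 3 * eta * Num.min 1 eps <= E ^+ 3 * eta * eps.
  by rewrite ler_wpM2l ?ge_min ?lexx ?orbT// mulr_ge0// exprn_ge0// ltW.
by rewrite /kappa -/E; lra.
Qed.

(** The node r carries the gap K from the outset since F_r <= 0; each epoch adds a
    node as long as one is left. *)
Lemma spread (K : R) k n : 0 <= K ->
  (forall j (x : R), tau k - hbar <= x -> F j x <= K) ->
  exists S : {set N}, [/\ r \in S, (minn n.+1 #|N| <= #|S|)%N &
    forall j (x : R), j \in S -> tau (k + n)%N - hbar <= x -> x <= tau (k + n)%N ->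
      F j x <= K - kappa ^+ n * K].
Proof.
move: hbar_ge0 => hb K0 FK; have FK' m j x : tau (k + m)%N - hbar <= x -> F j x <= K.
  move=> mx; apply: FK; apply: le_trans mx; rewrite lerD2r.
  elim: m => [|m ih]; first by rewrite addn0.
  by rewrite addnS; have h1 := tau_sigma (k + m)%N; have h2 := sigma_tau (k + m)%N; lra.
elim: n => [|n [S [rS cS FS]]].
  exists [set r]%SET; rewrite set11 cards1 geq_minl; split => // j x /set1P -> _ _.
  by rewrite expr0 mul1r subrr.
have /andP[kap0 _] := kappa_itv.
have eta0 : 0 <= kappa ^+ n * K by rewrite mulr_ge0// exprn_ge0// ltW.
have step := epoch_step eta0 (FK' n) FS.
have [ST|ST] := leqP #|N| #|S|.
  exists S; split => //; first by rewrite (leq_trans _ ST)// geq_minr.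
  move=> j x jS; rewrite addnS exprS -mulrA.
  by apply: (step S) => // i iS; left.
have [i [j [iS jS Ge]]] := arcs (k + n) rS ST.
exists (i |: S)%SET; split; first by rewrite !inE rS orbT.
  rewrite cardsU1 iS add1n; move: cS; rewrite !geq_min.
  by case/orP => H; [rewrite ltnS H|rewrite (leqW H) orbT].
move=> l x lS; rewrite addnS exprS -mulrA.
apply: (step (i |: S)%SET) => // l' /setU1P[->|]; last by left.
by right; exists j.
Qed.

Lemma contraction (K : R) k : 0 <= K ->
  (forall j (x : R), tau k - hbar <= x -> F j x <= K) ->
  forall j (x : R), tau (k + #|N|)%N - hbar <= x -> F j x <= (1 - kappa ^+ #|N|) * K.
Proof.
move=> K0 FK; have [S [_ + FS]] := spread #|N| K0 FK.
rewrite (minn_idPr (leqnSn _)) => cS.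
have ST j : j \in S.
  suff /setP/(_ j) : S = finset.setTfor N by rewrite !inE.
  by apply/eqP; rewrite eqEcard finset.subsetT cardsT.
apply: max_principle; first exact: tau_ge.
move=> j x x1 x2; have := FS j x (ST j) x1 x2.
by lra.
Qed.

Lemma geometric_decay (K : R) n : 0 <= K ->
  (forall j (x : R), tau 0%N - hbar <= x -> F j x <= K) ->
  forall j (x : R), tau (n * #|N|)%N - hbar <= x ->
    F j x <= (1 - kappa ^+ #|N|) ^+ n * K.
Proof.
move=> K0 FK; have /andP[kap0 kap1] := kappa_itv.
have q0 : 0 <= 1 - kappa ^+ #|N| by rewrite subr_ge0 exprn_ile1// ltW.
elim: n => [|n ih]; first by rewrite mul0n expr0 mul1r.
rewrite mulSn addnC exprS -mulrA; apply: contraction => //.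
by rewrite mulr_ge0// exprn_ge0.
Qed.

End delayed_inequality.

(** * Directed connectivity and spaced time windows *)

Lemma connect_crosses (N : finType) (e : rel N) (r v : N) (S : {set N}) :
  connect e r v -> r \in S -> v \notin S ->
  exists i j, [/\ i \notin S, j \in S & e j i].
Proof.
move=> /connectP[p ep ->]; elim: p r ep => [|x p ih] r /=; first by move=> _ ->.
move=> /andP[erx ep] rS; have [xS|xS _] := boolP (x \in S); first exact: ih.
by exists x, r.
Qed.

(** A node without incoming arcs is reachable only from itself, so it must be the
    root. *)
Lemma source_is_root (N : finType) (e : rel N) (r : N) :
  (forall x, ~~ e x r) -> quasi_strongly_connected e -> forall v, connect e r v.
Proof.
move=> er [r' H]; suff -> : r = r' by [].
have /connectP[p] := H r; case/lastP: p => [//|p x].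
rewrite rcons_path last_rcons => /andP[_ ex] rx; move: (er (last r' p)).
by rewrite rx ex.
Qed.

Section epochs.
Variables (R : realType) (t : nat -> R) (hbar t0 : R).
Hypothesis t_ge0 : 0 <= t 0%N.
Hypothesis t_lt : forall p, t p < t p.+1.
Hypothesis t_oo : t p @[p --> \oo] --> +oo.
Hypothesis hbar_ge0 : 0 <= hbar.

Lemma times_mono : {homo t : p q / (p <= q)%N >-> p <= q}.
Proof. by apply: homo_leq => [//|x y z|p]; [exact: le_trans|exact: ltW]. Qed.

Lemma times_unbounded x : exists p, x <= t p.
Proof.
have [n _ H] : \forall p \near \oo, x <= t p by move/cvgryPge : t_oo; exact.
by exists n; apply: H => /=.
Qed.

(** The least admissible index is taken, so that the time before it is still
    within the waiting period; this is what bounds the weight accumulated while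
    waiting. *)
Lemma next_epoch p : exists2 q, t p.+1 + hbar <= t q.+1 & t q < t p.+1 + hbar.
Proof.
have ex : exists q, t p.+1 + hbar <= t q by exact: times_unbounded.
case: (ex_minnP ex) => -[|q] Hq qmin.
  have := times_mono (leq0n p.+1); have := t_lt p; move: hbar_ge0; have := times_mono (leq0n p).
  by move=> h1 h2 h3 h4; lra.
by exists q => //; rewrite ltNge; apply/negP => /qmin; rewrite ltnn.
Qed.

(** Between consecutive chosen times lie one window, a waiting period of length
    hbar, and at most one further window: hence the bound C + D + C. *)
Lemma epochs (N : finType) (G : N -> N -> R -> R) (C D : R) :
  (forall i j u v, 0 <= u -> u <= v -> G i j u <= G i j v) ->
  (forall i j p, i != j -> G i j (t p.+1) - G i j (t p) <= C) ->
  (forall i j u, i != j -> 0 <= u -> G i j (u + hbar) - G i j u <= D) ->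
  exists p : nat -> nat, [/\ t0 <= t (p 0%N),
    forall k, t (p k).+1 + hbar <= t (p k.+1) &
    forall k i j, i != j -> G i j (t (p k.+1)) - G i j (t (p k)) <= C + D + C].
Proof.
move=> Gmono GC GD.
have [p0 Hp0] := times_unbounded t0.
have /choice[nxt Hnxt] : forall p, exists q, t p.+1 + hbar <= t q.+1 /\ t q < t p.+1 + hbar.
  by move=> p; have [q] := next_epoch p; exists q.
exists (fun k => iter k (fun p => (nxt p).+1) p0); split => //.
  by move=> k; rewrite iterS; exact: (Hnxt _).1.
move=> k i j ij; rewrite iterS; set p := iter k _ p0.
have [_ /ltW tq] := Hnxt p; set q := nxt p in tq *.
have t0' n : 0 <= t n by apply: le_trans t_ge0 (times_mono _).
have h1 := Gmono i j _ _ (t0' _) tq.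
have h2 := GC i j q ij; have h3 := GC i j p ij; have h4 := GD i j _ ij (t0' p.+1).
by lra.
Qed.

End epochs.

(** * Distance to a convex hull *)

Definition dot (R : realType) (m : nat) (u v : 'rV[R]_m) : R :=
  \sum_(c < m) u ord0 c * v ord0 c.

Section distance_to_hull.
Variables (R : realType) (m : nat).
Implicit Types (u v y z : 'rV[R]_m).

Lemma dot_ge0 u : 0 <= dot u u.
Proof. by apply: sumr_ge0 => c _; rewrite -expr2 sqr_ge0. Qed.

Lemma enorm_sqr u : enorm u ^+ 2 = dot u u.
Proof.
have -> : enorm u = Num.sqrt (dot u u).
  by rewrite /enorm; congr Num.sqrt; apply: eq_bigr => c _; rewrite expr2.
by rewrite sqr_sqrtr// dot_ge0.
Qed.

Lemma enorm_ge0 u : 0 <= enorm u. Proof. exact: sqrtr_ge0. Qed.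

Lemma dotBr u v w : dot u (v - w) = dot u v - dot u w.
Proof. by rewrite /dot -sumrB; apply: eq_bigr => c _; rewrite !mxE mulrBr. Qed.

Lemma dot_line u v (s : R) :
  dot (u - s *: v) (u - s *: v) = dot u u - 2 * s * dot u v + s ^+ 2 * dot v v.
Proof.
rewrite /dot !mulr_sumr -sumrB -big_split/=; apply: eq_bigr => c _.
by rewrite !mxE; ring.
Qed.

Lemma dotB_le u v : dot (u - v) (u - v) <= 2 * dot u u + 2 * dot v v.
Proof.
rewrite /dot !mulr_sumr -big_split/=; apply: ler_sum => c _; rewrite !mxE.
have : 0 <= (u ord0 c + v ord0 c) ^+ 2 by rewrite sqr_ge0.
by lra.
Qed.

Lemma convex_hull_segment (X : set 'rV[R]_m) z w (s : R) : 0 <= s <= 1 ->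
  convex_hull X z -> convex_hull X w -> convex_hull X (z + s *: (w - z)).
Proof.
move=> /andP[s0 s1] Xz Xw M /= MX; have Mz := Xz M MX; have Mw := Xw M MX.
case: MX => /(_ w z (Itv01 s0 s1)) + _; rewrite !inE => /(_ Mw Mz).
suff -> : z + s *: (w - z) = conv (Itv01 s0 s1) (w : convex_lmodType 'rV[R]_m) z by [].
rewrite /conv/= /unstable.onem scalerBr scalerBl scale1r.
by rewrite addrCA.
Qed.

Lemma dist_to_ge0 y (X : set 'rV[R]_m) : 0 <= dist_to y X.
Proof.
rewrite /dist_to; have [->|X0] := eqVneq [set enorm (y - z) | z in X] set0.
  by rewrite inf0.
by apply: lb_le_inf => [|_ [z _ <-]]; [exact/set0P|exact: enorm_ge0].
Qed.

Lemma dist_to_le y z (X : set 'rV[R]_m) : X z -> dist_to y X <= enorm (y - z).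
Proof.
move=> Xz; apply: ge_inf; last by exists z.
by exists 0 => _ [w _ <-]; exact: enorm_ge0.
Qed.

(** An approximate projection argument, which needs no closest point.  Suppose
    that d = dist > delta, pick z in the hull with |y - z|^2 < d^2 + eta, test with
    u = y - z, and move from z a small step s towards the leader w given by the
    hypothesis.  Then <u, w - z> >= d (d - delta) = kap, so the square of the
    distance drops by at least 2 s kap - s^2 |w - z|^2 >= s kap = eta, below d^2. *)
Lemma dist_hull_le (VL : finType) (xL : VL -> 'rV[R]_m) y (delta : R) :
  (0 < #|VL|)%N -> 0 <= delta ->
  (forall u, exists k, dot u (y - xL k) <= delta * enorm u) ->
  dist_to y (convex_hull (range xL)) <= delta.
Proof.
move=> /card_gt0P[k0 _] de0 H; rewrite leNgt; apply/negP.
set C := convex_hull _; set d := dist_to _ _ => ded.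
have d0 : 0 < d by exact: le_lt_trans ded.
have CL k : C (xL k) by move=> M [_]; apply; exists k.
pose kap := d * (d - delta).
have kap0 : 0 < kap by rewrite mulr_gt0// subr_gt0.
pose L := 2 * (\sum_k dot (y - xL k) (y - xL k)) + 2 * (d ^+ 2 + 1).
have sum0 : 0 <= \sum_k dot (y - xL k) (y - xL k) by apply: sumr_ge0 => k _; exact: dot_ge0.
have d20 : 0 <= d ^+ 2 by exact: sqr_ge0.
have L0 : 0 < L by rewrite /L; lra.
(* The step s balances its gain s kap against its cost s^2 L; moreover eta = s kap
   is at most 1, as the bound L on the square of |w - z| presupposes. *)
pose s := Num.min 1 (Num.min (kap / L) kap^-1).
have s0 : 0 < s by rewrite !lt_min ltr01 divr_gt0//= invr_gt0.
have s1 : s <= 1 by rewrite ge_min lexx.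
have sL : s * L <= kap.
  by rewrite -ler_pdivlMr// !ge_min lexx orbT.
have sk : s * kap <= 1.
  by rewrite -ler_pdivlMr// div1r !ge_min lexx !orbT.
pose eta := s * kap; have eta0 : 0 < eta by exact: mulr_gt0.
have [_ [z Cz <-] zd] : exists2 r, [set enorm (y - z) | z in C] r & r < Num.sqrt (d ^+ 2 + eta).
  have hi : has_inf [set enorm (y - z) | z in C].
    split; first by exists (enorm (y - xL k0)), (xL k0).
    by exists 0 => _ [w _ <-]; exact: enorm_ge0.
  have e0 : 0 < Num.sqrt (d ^+ 2 + eta) - d.
    rewrite subr_gt0 -[ltLHS](ger0_norm (ltW d0)) -sqrtr_sqr ltr_sqrt ?ltrDl//.
    by lra.
  have [r Xr] := inf_adherent e0 hi.
  by rewrite -/(dist_to y C) -/d addrC subrK; exists r.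
have dz : d <= enorm (y - z) by exact: dist_to_le.
set u := y - z in zd dz.
have Ud : dot u u < d ^+ 2 + eta.
  rewrite -enorm_sqr -[ltRHS]sqr_sqrtr; last by lra.
  by rewrite ltr_pXn2r// nnegrE ?enorm_ge0 ?sqrtr_ge0.
have [k uk] := H u; set w := xL k in uk.
have wz : w - z = u - (y - w).
  by rewrite /u opprB [RHS]addrC addrA subrK.
have uw : kap <= dot u (w - z).
  rewrite wz dotBr -enorm_sqr /kap.
  have : d * (d - delta) <= enorm u * (enorm u - delta).
    by apply: ler_pM => //; lra.
  by lra.
have ww : dot (w - z) (w - z) <= L.
  have wk : dot (y - w) (y - w) <= \sum_k dot (y - xL k) (y - xL k).
    by rewrite (bigD1 k)//= lerDl; apply: sumr_ge0 => l _; exact: dot_ge0.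
  by rewrite wz; have := dotB_le u (y - w); rewrite /L; move: sk; rewrite -/eta; lra.
have : d ^+ 2 <= dot (u - s *: (w - z)) (u - s *: (w - z)).
  rewrite -enorm_sqr ler_pXn2r// ?nnegrE ?enorm_ge0 ?(ltW d0)//.
  have -> : u - s *: (w - z) = y - (z + s *: (w - z)) by rewrite /u opprD addrA.
  apply: dist_to_le; apply: convex_hull_segment; [|exact: Cz|exact: CL].
  by apply/andP; split => //; exact: ltW.
rewrite dot_line.
have h1 : s * kap <= s * dot u (w - z) by rewrite ler_pM2l.
have h2 : s ^+ 2 * dot (w - z) (w - z) <= s * kap.
  rewrite expr2 -mulrA ler_pM2l// (le_trans _ sL)// ler_pM2l//.
by move: Ud; rewrite /eta => Ud h3; lra.
Qed.

End distance_to_hull.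

(** * Linear functionals of vector-valued trajectories *)

Section functionals_of_solutions.
Variables (R : realType) (m : nat) (u : 'rV[R]_m).

Lemma dotDr v w : dot u (v + w) = dot u v + dot u w.
Proof. by rewrite /dot -big_split; apply: eq_bigr => c _; rewrite !mxE mulrDr. Qed.

Lemma dotZr (s : R) v : dot u (s *: v) = s * dot u v.
Proof. by rewrite /dot mulr_sumr; apply: eq_bigr => c _; rewrite !mxE mulrCA. Qed.

Lemma dot_sumr (I : Type) (r : seq I) (P : pred I) (v : I -> 'rV[R]_m) :
  dot u (\sum_(i <- r | P i) v i) = \sum_(i <- r | P i) dot u (v i).
Proof.
apply: (big_morph (dot u) dotDr).
by rewrite /dot big1// => c _; rewrite mxE mulr0.
Qed.

Lemma coord_le_enorm (v : 'rV[R]_m) c : `|v ord0 c| <= enorm v.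
Proof.
rewrite -sqrtr_sqr; apply: ler_wsqrtr; rewrite (bigD1 c)//= lerDl.
by apply: sumr_ge0 => l _; exact: sqr_ge0.
Qed.

Lemma dot_le_enorm v : `|dot u v| <= (\sum_c `|u ord0 c|) * enorm v.
Proof.
rewrite mulr_suml (le_trans (ler_norm_sum _ _ _))//; apply: ler_sum => c _.
by rewrite normrM ler_wpM2l// coord_le_enorm.
Qed.

Lemma dot_le_sum v : dot u v <= enorm u * (\sum_c `|v ord0 c|).
Proof.
rewrite mulr_sumr; apply: ler_sum => c _.
by rewrite (le_trans (ler_norm _))// normrM ler_wpM2r// coord_le_enorm.
Qed.

Lemma dot_continuous : continuous (dot u : 'rV[R]_m -> R).
Proof.
rewrite /dot; apply: continuous_big => [|c _ v]; first exact: add_continuous.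
exact: (cvgM (cvg_cst (u ord0 c)) (@coord_continuous R 1 m ord0 c v)).
Qed.

Lemma is_derive_dot (x : R -> 'rV[R]_m) (t : R) D :
  is_derive (t : R^o) (1 : R^o) x D ->
  is_derive (t : R^o) (1 : R^o) (fun s => dot u (x s)) (dot u D).
Proof.
move=> [dx xD].
have cx : (fun h : R => h^-1 *: ((x \o shift t) (h *: (1 : R^o)) - x t)) @ 0^' --> D.
  by rewrite -xD; exact: dx.
have cf : (fun h : R => h^-1 *: (((fun s => dot u (x s)) \o shift t) (h *: (1 : R^o))
    - dot u (x t))) @ 0^' --> dot u D.
  rewrite (_ : (fun _ => _) = dot u \o
      (fun h : R => h^-1 *: ((x \o shift t) (h *: (1 : R^o)) - x t))).
    by apply: cvg_comp cx _; exact: dot_continuous.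
  by apply/funext => h /=; rewrite dotZr dotBr.
by apply: DeriveDef; [apply/cvg_ex; exists (dot u D)|apply/cvg_lim].
Qed.

(** The definition through indexed families of disjoint intervals entails the one
    through chains. *)
Lemma absolutely_continuous_dot (s t : R) (x : R -> 'rV[R]_m) :
  absolutely_continuous_on s t x -> ac s t (fun r => dot u (x r)).
Proof.
move=> acx e e0; pose k := \sum_c `|u ord0 c| + 1.
have k0 : 0 < k by rewrite ltr_wpDl// sumr_ge0.
have [d d0 H] := acx _ (divr_gt0 e0 k0); exists d => // l cl sd.
pose a i := (nth (0, 0) l i).1; pose b i := (nth (0, 0) l i).2.
have := H (size l) (fun i => a i) (fun i => b i).
have <- : \sum_(p <- l) (p.2 - p.1) = \sum_(i < size l) (b i - a i).
  by rewrite (big_nth (0, 0)) big_mkord.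
have <- : \sum_(p <- l) enorm (x p.2 - x p.1) = \sum_(i < size l) enorm (x (b i) - x (a i)).
  by rewrite (big_nth (0, 0)) big_mkord.
case/andP: cl => /allP al /(pairwiseP (0, 0)) pl.
move=> /(_ _ _ sd) K.
have {}K : \sum_(p <- l) enorm (x p.2 - x p.1) < e / k.
  apply: K => [i|]; first by have /andP[/andP[]] := al _ (mem_nth (0, 0) (ltn_ord i)).
  move=> i j _ _ [r /= []]; rewrite !in_itv/= => /andP[ai bi] /andP[aj bj].
  have nlt (i' j' : 'I_(size l)) : r < b i' -> a j' < r -> ~ (i' < j')%N.
    move=> rb ar ij; have : b i' <= a j' := pl _ _ (ltn_ord i') (ltn_ord j') ij.
    by rewrite leNgt (lt_trans ar rb).
  apply: ord_inj; have [ij|ji|//] := ltngtP i j.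
    by case: (nlt i j bi aj ij).
  by case: (nlt j i bj ai ji).
have : \sum_(p <- l) `|dot u (x p.2) - dot u (x p.1)| <= \sum_(p <- l) k * enorm (x p.2 - x p.1).
  apply: ler_sum => p _; rewrite -dotBr (le_trans (dot_le_enorm _))//.
  by rewrite ler_wpM2r ?enorm_ge0// lerDl.
rewrite -mulr_sumr => /le_lt_trans; apply.
by rewrite mulrC -ltr_pdivlMr.
Qed.

End functionals_of_solutions.

Lemma coord_le_norm (R : realType) (m : nat) (v : 'rV[R]_m) c : `|v ord0 c| <= `|v|.
Proof.
rewrite [leRHS]/Num.Def.normr/= mx_normrE; apply/bigmax_geP; right => /=.
by exists (ord0, c).
Qed.

Lemma history_bound (R : realType) (V VL : finType) (m : nat) (hbar t0 : R)
    (x0 : V -> 'rV[R]_m) (phi x : V -> R -> 'rV[R]_m) (xL : VL -> 'rV[R]_m) :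
  (forall i, [bounded phi i s | s in `[- hbar, 0[]) ->
  (forall i, x i t0 = x0 i) ->
  (forall i s, - hbar <= s -> s < 0 -> x i (t0 + s) = phi i s) ->
  exists2 K : R, 0 <= K & forall i k u s, t0 - hbar <= s -> s <= t0 ->
    dot u (x i s - xL k) <= enorm u * K.
Proof.
move=> phib xt0 xphi.
have /choice[M HM] : forall i, exists M : R, 0 <= M /\
    forall s, t0 - hbar <= s -> s <= t0 -> `|x i s| <= M.
  move=> i; have [M [_ H]] := phib i.
  exists (`|M| + 1 + `|x0 i|); split; first by rewrite !addr_ge0.
  move=> s s1; rewrite le_eqVlt => /predU1P[->|s2]; first by rewrite xt0 lerDr addr_ge0.
  have -> : x i s = phi i (s - t0) by rewrite -xphi ?subrKC//; lra.
  apply: (@le_trans _ _ (`|M| + 1)); last by rewrite lerDl.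
  apply: (H (`|M| + 1)); first by have := ler_norm M; lra.
  by rewrite /= in_itv/=; apply/andP; split; lra.
pose C := \sum_k \sum_c `|xL k ord0 c|.
have C0 : 0 <= C by apply: sumr_ge0 => k _; apply: sumr_ge0.
have sM0 : 0 <= \sum_i M i by apply: sumr_ge0 => i _; have [] := HM i.
exists (m%:R * (\sum_i M i) + C); first by rewrite addr_ge0// mulr_ge0.
move=> i k u s s1 s2; apply: (le_trans (dot_le_sum _ _)); rewrite ler_wpM2l ?enorm_ge0//.
apply: (@le_trans _ _ (\sum_c (`|x i s ord0 c| + `|xL k ord0 c|))).
  by apply: ler_sum => c _; rewrite !mxE ler_normB.
rewrite big_split/= lerD//.
  apply: (@le_trans _ _ (\sum_(c < m) \sum_i M i)); last first.
    by rewrite sumr_const card_ord mulr_natl.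
  apply: ler_sum => c _; rewrite (le_trans (coord_le_norm _ _))//.
  have [Mi0 Hi] := HM i; rewrite (le_trans (Hi s s1 s2))// (bigD1 i)//= lerDl.
  by apply: sumr_ge0 => j _; have [] := HM j.
rewrite /C (bigD1 k)//= lerDl; apply: sumr_ge0 => l _; exact: sumr_ge0.
Qed.

(** * The containment system *)

Lemma finite_sup_bound (R : realType) (X : set (\bar R)) : (ereal_sup X < +oo)%E ->
  exists C : R, forall r : R, X r%:E -> r <= C.
Proof.
move=> sX; exists (fine (ereal_sup X)) => r Xr.
have rs : (r%:E <= ereal_sup X)%E by exact: ereal_sup_ubound.
rewrite -lee_fin fineK// fin_numElt sX andbT.
by rewrite (lt_le_trans _ rs)// ltNyr.
Qed.

Lemma geometric_small (R : realType) (q K e : R) : 0 <= q -> q < 1 -> 0 < e ->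
  exists n, q ^+ n * K <= e.
Proof.
move=> q0 q1 e0; have : `|q| < 1 by rewrite ger0_norm.
move/cvg_expr => /cvgrPdist_lt/(_ (e / (`|K| + 1))).
have K1 : 0 < `|K| + 1 by rewrite ltr_wpDl.
rewrite divr_gt0// => /(_ isT)[n _ /(_ n (leqnn n))].
rewrite /= sub0r normrN ger0_norm ?exprn_ge0// ltr_pdivlMr// => H; exists n.
apply: le_trans (ltW H); rewrite ler_wpM2l ?exprn_ge0//.
by rewrite (le_trans (ler_norm _))// lerDl.
Qed.

Lemma sum_option (R : zmodType) (V : finType) (P : pred (option V)) (f : option V -> R) :
  P None -> \sum_(o | P o) f o = f None + \sum_(i | P (Some i)) f (Some i).
Proof.
move=> PN; rewrite (bigD1 None)//=; congr (_ + _).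
rewrite (reindex_omap Some id); last first.
  by case=> //= /andP[].
by apply: eq_bigl => i; rewrite eqxx !andbT.
Qed.

Section weights.
Variables (R : realType) (V VL : finType).
Variables (a : V -> V -> R -> R) (b : V -> VL -> R -> R).
Hypothesis a_ge0 : forall i j t, 0 <= t -> 0 <= a i j t.
Hypothesis a_int : forall i j, locally_lebesgue_integrable (a i j).
Hypothesis b_ge0 : forall i k t, 0 <= t -> 0 <= b i k t.
Hypothesis b_int : forall i k, locally_lebesgue_integrable (b i k).

Lemma hatA_ge0 i j t : 0 <= t -> 0 <= hatA a b i j t.
Proof.
by case: i j => [i|] [j|] //= t0; [exact: a_ge0|apply: sumr_ge0 => k _; exact: b_ge0].
Qed.

Lemma hatA_int i j : locally_lebesgue_integrable (hatA a b i j).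
Proof.
move=> T T0.
have mT : measurable (`[0, T]%classic : set (lebesgueTypeR R)).
  by apply: sub_caratheodory; exact: measurable_itv.
case: i j => [i|] [j|] /=; [exact: a_int| |exact: integrable0..].
have -> : EFin \o hatA a b (Some i) None = (fun t => \sum_k (b i k t)%:E)%E.
  by apply/funext => t /=; rewrite sumEFin.
by apply: integrable_sum => // k _; exact: b_int.
Qed.

Lemma hatA_primitive : exists G : option V -> option V -> R -> R,
  (forall i j, primitive (hatA a b i j) (G i j)) /\
  (forall i j (s t : R), 0 <= s -> s <= t ->
    (\int[leb]_(x in `[s, t]) (hatA a b i j x)%:E = (G i j t - G i j s)%:E)%E).
Proof.
have /choice[G HG] : forall ij : option V * option V, exists G,
    primitive (hatA a b ij.1 ij.2) G /\ forall s t : R, 0 <= s -> s <= t ->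
    (\int[leb]_(x in `[s, t]) (hatA a b ij.1 ij.2 x)%:E = (G t - G s)%:E)%E.
  move=> [i j]; have [x0|G pG iG] := primitive_exists _ (@hatA_int i j).
    exact: hatA_ge0.
  by exists G.
by exists (fun i j => G (i, j)); split=> i j; have [] := HG (i, j).
Qed.

End weights.

Lemma dot_rhs (R : realType) (V VL : finType) (m : nat)
    (a : V -> V -> R -> R) (b : V -> VL -> R -> R) (h : V -> V -> R -> R)
    (xL : VL -> 'rV[R]_m) (x : V -> R -> 'rV[R]_m) (i : V) (t : R) (u : 'rV[R]_m) :
  dot u (containment_rhs a b h xL x i t) =
  \sum_(j | j != i) a i j t * (dot u (x j (t - h i j t)) - dot u (x i t)) +
  \sum_k b i k t * (dot u (xL k) - dot u (x i t)).
Proof.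
rewrite /containment_rhs dotDr !dot_sumr.
by congr (_ + _); apply: eq_bigr => j _; rewrite dotZr dotBr.
Qed.

Section reduction.
Variables (R : realType) (V VL : finType) (m : nat).
Variables (a : V -> V -> R -> R) (b : V -> VL -> R -> R) (hbar : R).
Variables (h : V -> V -> R -> R).
Hypothesis b_ge0 : forall i k (t : R), 0 <= t -> 0 <= b i k t.
Variables (t0 : R) (xL : VL -> 'rV[R]_m) (x : V -> R -> 'rV[R]_m) (u : 'rV[R]_m).
Variable (k0 : VL).
Hypothesis k0_max : forall k, dot u (xL k) <= dot u (xL k0).
Hypothesis t0_ge0 : 0 <= t0.

Definition node_delay (i j : option V) (t : R) : R :=
  match i, j with Some i, Some j => h i j t | _, _ => 0 end.

Definition excess (i : option V) (t : R) : R :=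
  if i is Some i then dot u (x i t) - dot u (xL k0) else 0.

Lemma excess_ac i T : (forall i, locally_absolutely_continuous t0 (x i)) ->
  ac t0 T (excess i).
Proof.
move=> acx; case: i => [i|]; last exact: ac_cst.
apply: acB; last exact: ac_cst.
apply: (@acS _ t0 (Num.max t0 T)) => //; first by rewrite le_max lexx orbT.
by apply/absolutely_continuous_dot/acx; rewrite le_max lexx.
Qed.

(** All the leaders contribute to the derivative at most as much as the maximal
    one, whose excess is 0 and whose weight is the total weight of the leaders. *)
Lemma excess_derive t : t0 <= t ->
  (forall i, is_derive (t : R^o) (1 : R^o) (x i) (containment_rhs a b h xL x i t)) ->
  forall i, exists2 D : R, is_derive (t : R^o) (1 : R^o) (excess i) D &
    D <= \sum_(j | j != i) hatA a b i j t *
           (excess j (t - node_delay i j t) - excess i t).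
Proof.
move=> tt dx [i|]; last first.
  exists 0; first exact: is_derive_cst.
  by apply: sumr_ge0 => j _; rewrite mul0r.
exists (dot u (containment_rhs a b h xL x i t) - 0).
  by apply: (is_deriveB (g := cst (dot u (xL k0)))); apply: is_derive_dot.
rewrite subr0 dot_rhs sum_option//= addrC lerD//.
  rewrite mulr_suml; apply: ler_sum => k _.
  by rewrite ler_wpM2l ?b_ge0 ?(le_trans t0_ge0)//; have := k0_max k; lra.
by apply: ler_sum => j _; rewrite opprB addrA subrK.
Qed.

End reduction.

(** Each window is followed by a waiting period of length hbar.  Since many short
    windows may fit into it, the weight accumulated meanwhile is bounded through
    the uniform bound of the integrals, and not through the connectivity sequence;
    when hbar = 0 there is nothing to wait for. *)
Lemma aqsc_windows (R : realType) (V VL : finType) (a : V -> V -> R -> R)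
    (b : V -> VL -> R -> R) (G : option V -> option V -> R -> R) (hbar : R) :
  (forall i j (s t : R), 0 <= s -> s <= t ->
    (\int[leb]_(x in `[s, t]) (hatA a b i j x)%:E = (G i j t - G i j s)%:E)%E) ->
  (forall i j (u v : R), 0 <= u -> u <= v -> G i j u <= G i j v) ->
  0 <= hbar -> AQSC (hatA a b) ->
  (hbar = 0 \/ uniformly_bounded_integrals (hatA a b)) ->
  forall t0 : R, exists (eps C : R) (tau sigma : nat -> R),
   [/\ 0 < eps, 0 <= C, t0 <= tau 0%N /\ (forall k, 0 <= tau k),
     (forall k, tau k <= sigma k /\ sigma k + hbar <= tau k.+1) &
     (forall k i j, i != j -> G i j (tau k.+1) - G i j (tau k) <= C) /\
     (forall k (S : {set option V}), None \in S -> (#|S| < #|{: option V}|)%N ->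
        exists i j, [/\ i \notin S, j \in S & eps <= G i j (sigma k) - G i j (tau k)])].
Proof.
move=> GI Gmono hb [eps [t [eps0 t00 tlt too [conn supC]]]] unif t0.
have tmono := times_mono tlt.
have tge0 p : 0 <= t p by apply: le_trans t00 (tmono _ _ _).
have [C HC] := finite_sup_bound supC.
have {}HC i j p : i != j -> G i j (t p.+1) - G i j (t p) <= C.
  by move=> ij; apply: HC; exists p, i, j; split => //; rewrite GI// ltW.
have [D HD] : exists D, forall i j u, i != j -> 0 <= u -> G i j (u + hbar) - G i j u <= D.
  case: unif => [->|unif]; first by exists 0 => i j u _ _; rewrite addr0 subrr.
  have [hb0|hb0] := eqVneq hbar 0; first by exists 0 => i j u _ _; rewrite hb0 addr0 subrr.
  have /unif/finite_sup_bound[D HD] : 0 < hbar by rewrite lt_neqAle eq_sym hb0.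
  by exists D => i j u _ u0; apply: HD; exists u, i, j; split => //; rewrite GI// lerDl.
have [p [p0 pstep pG]] := epochs t0 t00 tlt too hb Gmono HC HD.
exists eps, (Num.max 0 (C + D + C)), (fun k => t (p k)), (fun k => t (p k).+1).
split => //.
- by rewrite le_max lexx.
- by move=> k; split; [rewrite ltW|exact: pstep].
split=> [k i j ij|k S NS cS].
  by rewrite le_max pG// orbT.
set M := fun i j => G i j (t (p k).+1) - G i j (t (p k)).
have ME i j : (\int[leb]_(s in `[t (p k), t (p k).+1]) hatA a b i j s)%R = M i j.
  by rewrite /Rintegral GI// ltW.
have := conn (p k); rewrite /quasi_strongly_eps_connected.
set e := (X in quasi_strongly_connected X) => eqsc.
have eE j i : e j i = (0 < M i j) && (eps <= M i j) by rewrite -!ME.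
have root x : ~~ e x None.
  have := GI None x _ _ (tge0 (p k)) (ltW (tlt (p k))).
  rewrite integral0_eq// => -[M0]; rewrite eE; apply/negP => /andP[+ _].
  by rewrite /M -M0 ltxx.
have [v vS] : exists v, v \notin S.
  apply/existsP; rewrite -negb_forall; apply/negP => /forallP H.
  by move: cS; rewrite ltnNge subset_leq_card//; apply/fintype.subsetP => v _; exact: H.
have [i [j [iS jS]]] := connect_crosses (source_is_root root eqsc v) NS vS.
by rewrite eE => /andP[_ H]; exists i, j.
Qed.

Theorem corollary2 (R : realType) (V VL : finType) (m : nat)
  (a : V -> V -> R -> R) (b : V -> VL -> R -> R)
  (hbar : R) (h : V -> V -> R -> R)
  (V_nonempty : (0 < #|V|)%N) (VL_nonempty : (0 < #|VL|)%N) (m_ge1 : (1 <= m)%N)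
  (a_ge0 : forall i j t, 0 <= t -> 0 <= a i j t)
  (a_int : forall i j, locally_lebesgue_integrable (a i j))
  (b_ge0 : forall i k t, 0 <= t -> 0 <= b i k t)
  (b_int : forall i k, locally_lebesgue_integrable (b i k))
  (hbar_ge0 : 0 <= hbar)
  (h_bound : forall i j t, 0 <= t -> 0 <= h i j t <= hbar)
  (h_meas : forall i j, lebesgue_measurable_fun `[0, +oo[ (h i j))
  (A_aqsc : AQSC (hatA a b))
  (A_unif : hbar = 0 \/ uniformly_bounded_integrals (hatA a b)) :
  provides_containment m a b hbar h.
Proof.
move=> t0 x0 phi xL x t00 phib [xt0 xphi xac dx] i.
have A0 := @hatA_ge0 _ _ _ a b a_ge0 b_ge0.
have [G [pG GI]] := hatA_primitive a_ge0 a_int b_ge0 b_int.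
have Gmono i' j' := primitive_nondecreasing (A0 i' j') (pG i' j').
have [eps [C [tau [sigma [eps0 C0 [tau0 taup] step [GC arcs]]]]]] :=
  aqsc_windows GI Gmono hbar_ge0 A_aqsc A_unif t0.
have [K K0 HK] := history_bound xL (fun i => (phib i).2) xt0 xphi.
pose N : finType := option V; pose Bd : R := #|N|%:R * C.
have Bd0 : 0 <= Bd by rewrite mulr_ge0.
pose kappa : R := expR (- Bd) ^+ 3 * Num.min 1 eps.
have /andP[kap0 kap1] : 0 < kappa <= 1 := kappa_itv Bd0 eps0.
pose q := 1 - kappa ^+ #|N|.
have q0 : 0 <= q by rewrite subr_ge0 exprn_ile1// ltW.
have q1 : q < 1 by rewrite ltrBlDr ltrDl exprn_gt0.
(* The number n of contractions is fixed before the direction u is chosen. *)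
apply/cvgrPdist_le => e e0; have [n qn] := geometric_small K q0 q1 e0.
near=> t; rewrite sub0r normrN ger0_norm ?dist_to_ge0//.
apply: dist_hull_le => //; first exact: ltW.
move=> u; have /card_gt0P[k1 _] := VL_nonempty.
pose k0 := [arg max_(k > k1) dot u (xL k)]%O.
have k0max k : dot u (xL k) <= dot u (xL k0).
  by rewrite /k0; case: arg_maxP => // l _; exact.
exists k0; rewrite dotBr.
pose F := excess xL x u k0; pose H := node_delay h.
have Hb (i' j' : N) (s : R) : 0 <= s -> 0 <= H i' j' s <= hbar.
  by move=> s0; case: i' j' => [i'|] [j'|]; rewrite /= ?lexx// h_bound.
have Fac (j : N) T : ac t0 T (F j) by exact: excess_ac.
have Fsub : {ae (@lebesgue_measure R), forall t : R, t0 <= t -> forall i,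
    exists2 D : R, is_derive (t : R^o) (1 : R^o) (F i) D &
    D <= \sum_(j | j != i) hatA a b i j t * (F j (t - H i j t) - F i t)}.
  have {}dx := leb_ae dx.
  apply: filterS dx => s ds ts; exact: (excess_derive b_ge0 k0max t00 ts (ds ts)).
have Froot s : F None s <= 0 by [].
have massB k (i' : N) :
    \sum_(j | j != i') G i' j (tau k.+1) - \sum_(j | j != i') G i' j (tau k) <= Bd.
  rewrite -sumrB big_mkcond/= (@le_trans _ _ (\sum_(j : N) C))//.
    by apply: ler_sum => j _; case: ifPn => // ji; apply: GC; rewrite eq_sym.
  by rewrite sumr_const -mulr_natl.
have F0 j s : tau 0%N - hbar <= s -> F j s <= enorm u * K.
  move=> ts; apply: (max_principle A0 pG t00 hbar_ge0 Hb Fac Fsub (lexx t0)); last first.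
    by apply: le_trans ts; rewrite lerD2r.
  move=> [j'|] s' s1 s2; last by rewrite mulr_ge0// enorm_ge0.
  by rewrite /F/= -dotBr; exact: HK.
have := @geometric_decay R N _ _ _ _ _ F A0 pG t00 hbar_ge0 Hb Fac Fsub Bd eps tau sigma None
  Bd0 eps0 tau0 (fun k => (step k).1) (fun k => (step k).2) massB arcs Froot
  (enorm u * K) n _ F0 (Some i) t.
rewrite -/kappa -/q => Fx; apply: (le_trans (Fx _ _)).
- by rewrite mulr_ge0// enorm_ge0.
- by near: t; apply: nbhs_pinfty_ge; rewrite num_real.
by rewrite mulrCA [leRHS]mulrC ler_wpM2l ?enorm_ge0.
Unshelve. all: by end_near. Qed.
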